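(* Let $n \ge 2$ be an integer, $p > 1$ a real number with $n > p$, let $\varepsilon > 0$, and let $f : [0,\infty) \to [0,\infty)$ be a function that is non-decreasing on $[0,\varepsilon]$. Suppose that $$\int_0^\varepsilon \frac{f(\zeta)\, d\zeta}{\zeta^{1 + n(p-1)/(n-p)}} < \infty.$$ Then there exists a positive solution $u$ of the inequality $$-\Delta_p u \ge f(u) \quad \text{in } \mathbb{R}^n$$ satisfying $\operatorname{ess\,inf}_{\mathbb{R}^n} u = 0$.
   Context: $\Delta_p u = \operatorname{div}(|\nabla u|^{p-2} \nabla u)$ is the $p$-Laplace operator. A solution of $-\Delta_p u \ge f(u)$ in $\mathbb{R}^n$ is a function $u \in W^1_{p,loc}(\mathbb{R}^n)$ (the local Sobolev space of functions which, together with their first weak derivatives, are in $L_{p,loc}$) such that $f(u) \in L_{1,loc}(\mathbb{R}^n)$ and $$\int_{\mathbb{R}^n} |\nabla u|^{p-2} \nabla u \cdot \nabla \varphi \, dx \ge \int_{\mathbb{R}^n} f(u)\, \varphi \, dx$$ for every non-negative $\varphi \in C_0^\infty(\mathbb{R}^n)$. *)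

(* Defs.v *)
From HB Require Import structures.
From mathcomp Require Import all_boot all_order all_algebra.
From mathcomp Require Import all_classical all_reals all_analysis.

Set Implicit Arguments.
Unset Strict Implicit.
Unset Printing Implicit Defensive.

Import Order.TTheory GRing.Theory Num.Theory.
Import numFieldNormedType.Exports.

Local Open Scope classical_set_scope.
Local Open Scope ring_scope.

(* The measurable sets of 'rV[T]_n are those of the product sigma-algebra
   (for T = R, the Borel sets of R^n). *)
Definition measure_rV_display : measure_display -> measure_display.
Proof. exact. Qed.

Section measurable_rV.
Context {d} {T : measurableType d}.
Variable n : nat.

Let coors : 'I_n -> 'rV[T]_n -> T := fun i v => v 0 i.

Let rV_set0 : g_sigma_preimage coors set0.
Proof. exact: sigma_algebra0. Qed.

Let rV_setC A : g_sigma_preimage coors A -> g_sigma_preimage coors (~` A).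
Proof. exact: sigma_algebraC. Qed.

Let rV_bigcup (F : _^nat) : (forall i, g_sigma_preimage coors (F i)) ->
  g_sigma_preimage coors (\bigcup_i (F i)).
Proof. exact: sigma_algebra_bigcup. Qed.

HB.instance Definition _ := @isMeasurable.Build (measure_rV_display d)
  'rV[T]_n (g_sigma_preimage coors) rV_set0 rV_setC rV_bigcup.

End measurable_rV.

Section measurable_fun_rV.
Context d1 d2 (T1 : measurableType d1) (T2 : measurableType d2).

Lemma measurable_coord n (i : 'I_n) :
  measurable_fun [set: 'rV[T2]_n] (fun v => v 0 i).
Proof.
move=> _ Y mY; rewrite setTI; apply: sub_sigma_algebra => /=.
rewrite -bigcup_seq/=; exists i => /=; first by rewrite mem_index_enum.
by exists Y => //; rewrite setTI.
Qed.

Lemma measurable_fun_rVP n (f : T1 -> 'rV[T2]_n) :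
  measurable_fun [set: T1] f <->
  forall i, measurable_fun [set: T1] (fun x => f x 0 i).
Proof.
split=> [mf i|mf].
  by apply: (@measurableT_comp _ _ _ _ _ _ (fun v : 'rV[T2]_n => v 0 i)) => //;
    exact: measurable_coord.
have : g_sigma_preimage (fun i x => f x 0 i) `<=` measurable.
  apply: smallest_sub; first exact: sigma_algebra_measurable.
  case: n => [|n] in f mf *; first by rewrite big_ord0.
  rewrite -bigcup_mkord_ord; apply: bigcup_sub => i Ii.
  by move=> A [B mB <-]; exact: mf.
have -> : g_sigma_preimage (fun i x => f x 0 i) =
    preimage_set_system [set: T1] f
      (g_sigma_preimage (fun i (v : 'rV[T2]_n) => v 0 i)).
  exact: (g_sigma_preimage_comp (fun i (v : 'rV[T2]_n) => v 0 i) f).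
by move=> sub _ A mA; apply: sub; exists A.
Qed.

End measurable_fun_rV.

Section lebesgue_measure_rV.
Context {R : realType}.
Local Open Scope ereal_scope.

Definition cons_rV n (xv : measurableTypeR R * 'rV[R]_n) : 'rV[R]_n.+1 :=
  \row_i if unlift ord0 i is Some j then xv.2 ord0 j else xv.1.

Definition uncons_rV n (v : 'rV[R]_n.+1) : measurableTypeR R * 'rV[R]_n :=
  (v ord0 ord0, \row_j v ord0 (lift ord0 j)).

Lemma cons_rVK n : cancel (@cons_rV n) (@uncons_rV n).
Proof.
case=> x v; rewrite /uncons_rV /cons_rV mxE unlift_none; congr pair.
by apply/rowP => j; rewrite !mxE liftK.
Qed.

Lemma uncons_rVK n : cancel (@uncons_rV n) (@cons_rV n).
Proof.
move=> v; apply/rowP => i; rewrite /uncons_rV /cons_rV mxE/=.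
by case: unliftP => [j ->|->]//; rewrite mxE.
Qed.

Lemma measurable_cons_rV n :
  measurable_fun [set: measurableTypeR R * 'rV[R]_n] (@cons_rV n).
Proof.
apply/measurable_fun_rVP => i; rewrite /cons_rV.
case: (unliftP ord0 i) => [j ij|i0].
  rewrite (_ : (fun _ => _) = (fun v : 'rV[R]_n => v ord0 j) \o snd); last first.
    by apply/funext => -[x v]/=; rewrite mxE ij liftK.
  exact: measurableT_comp (measurable_coord _) measurable_snd.
rewrite (_ : (fun _ => _) = fst)//.
by apply/funext => -[x v]/=; rewrite mxE i0 unlift_none.
Qed.

Lemma measurable_uncons_rV n : measurable_fun [set: 'rV[R]_n.+1] (@uncons_rV n).
Proof.
apply: measurable_fun_pair => /=; first exact: measurable_coord.
apply/measurable_fun_rVP => j /=.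
under eq_fun do rewrite mxE.
exact: measurable_coord.
Qed.

Let image_cons n (mu : {sigma_finite_measure set 'rV[R]_n -> \bar R}) :
    set 'rV[R]_n.+1 -> \bar R :=
  pushforward (@lebesgue_measure R \x mu) (@cons_rV n).

Section image_cons.
Variables (n : nat) (mu : {sigma_finite_measure set 'rV[R]_n -> \bar R}).

Let nu : {measure set (measurableTypeR R * 'rV[R]_n)%type -> \bar R} :=
  (@lebesgue_measure R \x mu).

Let measurable_pre A : measurable A -> measurable (@cons_rV n @^-1` A).
Proof.
by move=> mA; rewrite -[X in measurable X]setTI; exact: measurable_cons_rV.
Qed.

Let image_cons0 : image_cons mu set0 = 0.
Proof. by rewrite /image_cons /pushforward preimage_set0 measure0. Qed.

Let image_cons_ge0 A : 0 <= image_cons mu A.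
Proof. exact: (measure_ge0 nu). Qed.

Let image_cons_sigma_additive : semi_sigma_additive (image_cons mu).
Proof.
move=> F mF tF mUF; rewrite /image_cons /pushforward preimage_bigcup.
apply: (@measure_semi_sigma_additive _ _ _ nu) => [k||].
- exact: measurable_pre.
- apply/trivIsetP => /= i j _ _ ij; rewrite -preimage_setI.
  by move/trivIsetP : tF => /(_ _ _ _ _ ij) ->//; rewrite preimage_set0.
- by rewrite -preimage_bigcup; exact: measurable_pre.
Qed.

HB.instance Definition _ := isMeasure.Build _ _ _ (image_cons mu)
  image_cons0 image_cons_ge0 image_cons_sigma_additive.

Let nu_sigma_finite : sigma_finite setT nu.
Proof.
have /sigma_finiteP[F [TF ndF Foo]] := sigma_finiteT (@lebesgue_measure R).
have /sigma_finiteP[G [TG ndG Goo]] := sigma_finiteT mu.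
exists (fun k => F k `*` G k).
  rewrite -setXTT TF TG predeqE => -[x y]; split.
    move=> [/= [i _ Fx] [j _ Gy]]; exists (maxn i j) => //; split.
    - by move: x Fx; exact/subsetPset/ndF/leq_maxl.
    - by move: y Gy; exact/subsetPset/ndG/leq_maxr.
  by move=> [k _ []/= ? ?]; split; exists k.
move=> k; have [? ?] := Foo k; have [? ?] := Goo k.
split; first exact: measurableX.
by rewrite /nu/= product_measure1E// lte_mul_pinfty// ge0_fin_numE.
Qed.

Let image_cons_sigma_finite : sigma_finite setT (image_cons mu).
Proof.
have [F TF Foo] := nu_sigma_finite.
have FE k : @cons_rV n @^-1` (@uncons_rV n @^-1` F k) = F k.
  by rewrite -comp_preimage; apply/seteqP; split=> x; rewrite /= cons_rVK.
exists (fun k => @uncons_rV n @^-1` F k).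
  by rewrite -preimage_bigcup -TF preimage_setT.
move=> k; have [mF Fk] := Foo k; split; last by rewrite /image_cons /pushforward FE.
by rewrite -[X in measurable X]setTI; exact: measurable_uncons_rV.
Qed.

HB.instance Definition _ := Measure_isSigmaFinite.Build _ _ _ (image_cons mu)
  image_cons_sigma_finite.

End image_cons.

Fixpoint lebesgue_measure_rV (n : nat) : set 'rV[R]_n -> \bar R :=
  match n with
  | 0%N => \d_(0%R : 'rV[R]_0)
  | m.+1 => fun A =>
      (@lebesgue_measure R \x lebesgue_measure_rV (n := m)) (@cons_rV m @^-1` A)
  end.

Let lebesgue_measure_rV_ex n :
  exists mu : {sigma_finite_measure set 'rV[R]_n -> \bar R},
    @lebesgue_measure_rV n = mu :> (set _ -> \bar R).
Proof.
elim: n => [|n [mu muE]].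
  by exists (\d_(0%R : 'rV[R]_0) : {sigma_finite_measure set _ -> \bar R}).
exists (image_cons mu : {sigma_finite_measure set _ -> \bar R}).
by rewrite /= muE.
Qed.

Section lebesgue_measure_rV_measure.
Variable n : nat.
Local Notation leb := (@lebesgue_measure_rV n).

Let leb0 : leb set0 = 0.
Proof. by have [mu ->] := lebesgue_measure_rV_ex n. Qed.

Let leb_ge0 A : 0 <= leb A.
Proof. by have [mu ->] := lebesgue_measure_rV_ex n. Qed.

Let leb_sigma_additive : semi_sigma_additive leb.
Proof.
by have [mu ->] := lebesgue_measure_rV_ex n; exact: measure_semi_sigma_additive.
Qed.

HB.instance Definition _ :=
  isMeasure.Build _ _ _ leb leb0 leb_ge0 leb_sigma_additive.

Let leb_sigma_finite : sigma_finite setT leb.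
Proof.
have [mu ->] := lebesgue_measure_rV_ex n.
exact: (sigma_finiteT mu).
Qed.

HB.instance Definition _ :=
  Measure_isSigmaFinite.Build _ _ _ leb leb_sigma_finite.

End lebesgue_measure_rV_measure.

Lemma lebesgue_measure_rV_box n (A : 'I_n -> set R) :
  (forall i, measurable (A i)) ->
  lebesgue_measure_rV [set v : 'rV[R]_n | forall i, A i (v ord0 i)] =
  \prod_(i < n) lebesgue_measure (A i).
Proof.
elim: n A => [|n IHn] A mA.
  by rewrite big_ord0/= diracE mem_set//; case.
rewrite big_ord_recl -IHn//= -product_measure1E//.
  congr (_ _); apply/seteqP; split=> [[x v]/= Axv|[x v]/= [Ax Av] i].
    split=> /=; first by have := Axv ord0; rewrite /cons_rV mxE unlift_none.
    by move=> i; have := Axv (lift ord0 i); rewrite /cons_rV mxE liftK.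
  by rewrite /cons_rV mxE/=; case: unliftP => [j ->|->].
  exact: mA.
rewrite (_ : [set v | _] = \bigcap_(i : 'I_n)
    ((fun v : 'rV[R]_n => v ord0 i) @^-1` A (lift ord0 i))); last first.
  by apply/seteqP; split=> [v Av i _|v Av i]; exact: Av.
apply: fin_bigcap_measurable => // i _.
by rewrite -[X in measurable X]setTI; exact: measurable_coord.
Qed.

End lebesgue_measure_rV.
Arguments lebesgue_measure_rV {R n}.

Section differential_inequality.
Context {R : realType} {n : nat}.
Local Notation mu := (@lebesgue_measure_rV R n).
Implicit Types (p : R) (u phi : 'rV[R]_n -> R) (G : 'rV[R]_n -> 'rV[R]_n).

Definition dotrv (v w : 'rV[R]_n) : R := \sum_(i < n) v 0 i * w 0 i.

(* The norm `|v| of the library on 'rV[R]_n is the sup norm. *)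
Definition enorm (v : 'rV[R]_n) : R := Num.sqrt (dotrv v v).

Definition partial (i : 'I_n) phi : 'rV[R]_n -> R :=
  fun x => 'D_(delta_mx 0 i) phi x.

Definition gradient phi : 'rV[R]_n -> 'rV[R]_n :=
  fun x => \row_i partial i phi x.

Definition smooth phi : Prop :=
  forall s : seq 'I_n, let psi := foldr partial phi s in
    continuous psi /\ forall i x, derivable psi x (delta_mx 0 i).

Definition test_function phi : Prop :=
  smooth phi /\ compact (closure [set x | phi x != 0]).

Definition Lploc p u : Prop :=
  measurable_fun setT u /\
  forall K, compact K -> (\int[mu]_(x in K) (`|u x| `^ p)%:E < +oo)%E.

Definition weak_gradient u G : Prop :=
  forall phi, test_function phi -> forall i,
    (\int[mu]_x (u x * partial i phi x)%:E =
     - \int[mu]_x (G x 0 i * phi x)%:E)%E.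

Definition W1ploc p u G : Prop :=
  [/\ Lploc p u, forall i, Lploc p (fun x => G x 0 i) & weak_gradient u G].

(* The exponent p - 2 may be negative: by 0 `^ a = 0 for a != 0, the field
   |G|^(p-2) G is 0 where the weak gradient G of u vanishes.
   Only the values of f on the range of u matter, so a function on [0, +oo[
   is represented by any extension to R, provided u >= 0. *)
Definition plaplace_solution p (f : R -> R) u : Prop :=
  exists2 G, W1ploc p u G &
    Lploc 1 (f \o u) /\
    forall phi, test_function phi -> (forall x, 0 <= phi x) ->
      (\int[mu]_x (f (u x) * phi x)%:E <=
       \int[mu]_x (enorm (G x) `^ (p - 2) * dotrv (G x) (gradient phi x))%:E)%E.

End differential_inequality.

(* Main.v *)
(* The solution is radial, u(x) = w(|x|), and its flux |grad u|^(p-2) grad u is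
   - Q(|x|^2) x, so that the inequality reads
   n Q(rho) + 2 rho Q'(rho) >= f(w(sqrt rho)).
   With Q(rho) = s^(-n/2) mu(s), s = rho + lam, the left-hand side is
   s^(-n/2) (n lam mu / s + 2 rho mu').  If mu <= M, then w is at most
   Z = C s^(-a/2), a = (n - p)/(p - 1), with C proportional to M^(1/(p-1)).
   It remains to find a bounded increasing C^1 function mu with
   mu' >= const f(Z) Z^(-N) / s, where N = n/a.  This is where the integral
   condition enters: for the primitive Phi of f(z) z^(-1-N), which is bounded
   and continuous, monotonicity of f gives
   Phi(2z) - Phi(z) >= const f(z) z^(-N), and (Phi(2Z) - Phi(Z)) / s is the
   derivative of a bounded C^1 function, even when f is discontinuous.  As
   C^N is proportional to M^(n/(n-p)) with n/(n-p) > 1, the size of the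
   source is under control for small M.
   The field Q(|x|^2) x and u are C^1, so the weak formulation follows from
   integration by parts on lines. *)
Require Import Defs.
From HB Require Import structures.
From mathcomp Require Import all_boot all_order all_algebra.
From mathcomp Require Import all_classical all_reals all_analysis.
From mathcomp Require Import ess_sup_inf measurable_realfun.
From mathcomp Require Import ring lra.

Set Implicit Arguments.
Unset Strict Implicit.
Unset Printing Implicit Defensive.

Import Order.TTheory GRing.Theory Num.Theory.
Import numFieldNormedType.Exports.

Local Open Scope classical_set_scope.
Local Open Scope ring_scope.

(** * Borel sets of R^n *)

Lemma rV_ballE (R : realType) n (x y : 'rV[R]_n) e :
  0 < e -> ball x e y <-> forall i, `|x 0 i - y 0 i| < e.
Proof.
move=> e0; split=> [[_ xy] i|xy]; first exact: xy.
by split=> // i j; rewrite ord1; exact: xy.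
Qed.

Lemma measurable_rV_box (R : realType) n (A : 'I_n -> set R) :
  (forall i, measurable (A i)) ->
  measurable [set v : 'rV[R]_n | forall i, A i (v 0 i)].
Proof.
move=> mA; rewrite (_ : [set v | _] = \bigcap_(i : 'I_n)
    ((fun v : 'rV[R]_n => v 0 i) @^-1` A i)); last first.
  by apply/seteqP; split=> [v Av i _|v Av i]; exact: Av.
apply: fin_bigcap_measurable => // i _.
by rewrite -[X in measurable X]setTI; exact: measurable_coord.
Qed.

(* An open set is the union of the rational cubes that it contains. *)
Lemma open_measurable_rV (R : realType) n (U : set 'rV[R]_n) :
  open U -> measurable U.
Proof.
move=> oU.
pose cube (q : 'rV[rat]_n * rat) : set 'rV[R]_n :=
  [set v | forall i, `|ratr (q.1 0 i) - v 0 i| < ratr q.2].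
pose F (q : 'rV[rat]_n * rat) := if `[< cube q `<=` U >] then cube q else set0.
rewrite (_ : U = \bigcup_q F q).
  apply: (@countable_bigcupT_measurable _ _ _ F (countableP _)) => q.
  rewrite /F; case: asboolP => // _.
  apply: (@measurable_rV_box _ _ (fun i => ball (ratr (q.1 0 i) : R) (ratr q.2))).
  by move=> i; apply: open_measurable; exact: ball_open.
apply/seteqP; split=> [v Uv|v [q _]]; last first.
  by rewrite /F; case: asboolP => // qU qv; exact: qU.
have /nbhs_ballP[e /= e0 eU] : nbhs v U by exact: open_nbhs_nbhs.
(* If the rational centre is within [r] of [v], the cube of radius [r] contains [v], and its points
   are within [2 * r < e] of [v]. *)
have [r] := @rat_in_itvoo R 0 (e / 2) ltac:(lra).
rewrite in_itv/= => /andP[r0 re].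
have /all_sig[q qP] (i : 'I_n) : {q : rat | `|ratr q - v 0 i| < ratr r :> R}.
  apply/cid.
  have [q] := @rat_in_itvoo R (v 0 i - ratr r) (v 0 i + ratr r) ltac:(lra).
  by rewrite in_itv/= => qi; exists q; rewrite ltr_distl; lra.
exists (\row_i q i, r) => //; rewrite /F; case: asboolP => [_ i/=|].
  by rewrite mxE; exact: qP.
case=> w /= qw; apply: eU; apply/rV_ballE => // i.
have := qw i; rewrite mxE => {}qw; have := qP i; rewrite distrC => qv.
rewrite -(subrKA (ratr (q i))) (le_lt_trans (ler_normD _ _))//; lra.
Qed.

Lemma continuous_measurable_rV (R : realType) n (f : 'rV[R]_n -> R) :
  continuous f -> measurable_fun setT f.
Proof.
move=> /continuousP cf; apply: (measurability _ (RGenOpens.measurableE R)).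
move=> _ [_ [a [b ->]] <-]; rewrite setTI; apply: open_measurable_rV.
by apply: cf; exact: interval_open.
Qed.

Lemma compact_measurable_rV (R : realType) n (K : set 'rV[R]_n) :
  compact K -> measurable K.
Proof.
move=> /compact_closed -/(_ (@norm_hausdorff _ _)) cK.
rewrite -(setCK K); apply: measurableC; apply: open_measurable_rV.
exact: closed_openC.
Qed.

(** Closed cubes stand in for compact supports: a slice of a cube by a coordinate is again a cube,
    which suits induction on the dimension. *)
Definition cube (R : realType) n (b : R) : set 'rV[R]_n :=
  [set v | forall i, v 0 i \in `[- b, b]].

Lemma measurable_cube (R : realType) n (b : R) : measurable (@cube R n b).
Proof. exact: (@measurable_rV_box _ _ (fun=> [set` `[- b, b]])). Qed.

Lemma lebesgue_measure_cube_fin (R : realType) n (b : R) :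
  (lebesgue_measure_rV (@cube R n b) < +oo)%E.
Proof.
rewrite (@lebesgue_measure_rV_box _ _ (fun=> [set` `[- b, b]]))//.
rewrite -ge0_fin_numE; last first.
  by apply: prode_ge0 => i _.
apply: (big_ind (fun x => x \is a fin_num)) => //= [x y|i _]; first exact: fin_numM.
by rewrite lebesgue_measure_itv/= lte_fin; case: ifP.
Qed.

Lemma compact_sub_cube (R : realType) n (K : set 'rV[R]_n) : compact K ->
  exists b : R, K `<=` cube b.
Proof.
move=> /compact_bounded[M [_ KM]].
exists (`|M| + 1) => v Kv i /=; rewrite in_itv/= -ler_norml.
have := KM (`|M| + 1) _ v Kv; rewrite ltr_pwDr ?ler_norm// => /(_ isT).
move=> /= vM; apply: le_trans vM; rewrite -[`|v|]/(mx_norm v) mx_normrE.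
exact: (le_bigmax _ (fun ij => `|v ij.1 ij.2|) (0, i)).
Qed.

(** * Integration by parts in R^n *)

Lemma cube_compact (R : realType) n (b : R) : compact (@cube R n b).
Proof.
apply: (@rV_compact _ _ (fun=> [set` `[- b, b]])) => _.
exact: segment_compact.
Qed.

(** By compactness [g] is bounded on the cube, which has finite measure. *)
Lemma integrable_cube (R : realType) n (g : 'rV[R]_n -> R) b : continuous g ->
  (forall x, ~ cube b x -> g x = 0) ->
  lebesgue_measure_rV.-integrable setT (EFin \o g).
Proof.
move=> cg g0.
have -> : EFin \o g = (EFin \o g) \_ (cube b).
  apply/funext => x; rewrite patchE; case: ifPn => // /negP xb /=.
  by rewrite g0// => /mem_set.
apply/integrable_restrict => //; first exact: measurable_cube.
rewrite setTI; apply: measurable_bounded_integrable.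
- exact: measurable_cube.
- exact: lebesgue_measure_cube_fin.
- exact: measurable_funTS (continuous_measurable_rV cg).
- have : compact (g @` cube b).
    apply: continuous_compact; last exact: cube_compact.
    exact: continuous_subspaceT.
  move=> /compact_bounded[M [Mr gM]]; exists M; split => // x Mx y by_.
  by apply: (gM x Mx); exists y.
Qed.

(** This identity and [cons_rV_lift] carry directional derivatives over to the slices used in
    Fubini's theorem. *)
Lemma cons_rV0 (R : realType) n h (t : R) (v : 'rV[R]_n) :
  cons_rV (h + t, v) = h *: delta_mx 0 ord0 + cons_rV (t, v).
Proof.
apply/rowP => i; rewrite !mxE /=; case: (unliftP ord0 i) => [j ->|->] /=.
  by rewrite mulr0 add0r.
by rewrite mulr1.
Qed.

Lemma cons_rV_lift (R : realType) n h (t : R) (v : 'rV[R]_n) j :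
  cons_rV (t, h *: delta_mx 0 j + v) =
  h *: delta_mx 0 (lift ord0 j) + cons_rV (t, v).
Proof.
apply/rowP => i; rewrite !mxE /=; case: (unliftP ord0 i) => [k ->|->] /=.
  by rewrite !mxE !eqxx (inj_eq lift_inj).
by rewrite mulr0 add0r.
Qed.

Lemma cons_rV_continuous (R : realType) n (t : R) :
  continuous (fun v : 'rV[R]_n => cons_rV (t, v)).
Proof.
move=> v A /nbhs_ballP[e /= e0 eA]; apply/nbhs_ballP; exists e => //= w.
move=> /(rV_ballE _ _ e0) vw; apply: eA; apply/rV_ballE => // i.
rewrite !mxE/=; case: (unliftP ord0 i) => [k _|_] //=.
by rewrite subrr normr0.
Qed.

Lemma cons_rV_continuous1 (R : realType) n (v : 'rV[R]_n) :
  continuous (fun t : R => cons_rV (t, v)).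
Proof.
move=> t A /nbhs_ballP[e /= e0 eA]; apply/nbhs_ballP; exists e => //= w.
move=> tw; apply: eA; apply/rV_ballE => // i.
rewrite !mxE/=; case: (unliftP ord0 i) => [k _|_] //=.
by rewrite subrr normr0.
Qed.

Lemma cube_cons (R : realType) n b (t : R) (v : 'rV[R]_n) :
  cube b (cons_rV (t, v)) <-> t \in `[- b, b] /\ cube b v.
Proof.
split=> [bv|[bt bv] i].
  by split=> [|i]; [have := bv ord0|have := bv (lift ord0 i)];
    rewrite mxE/= ?unlift_none ?liftK.
by rewrite mxE/=; case: (unliftP ord0 i) => [j _|_].
Qed.

(** * Fubini's theorem for continuous functions supported in a cube *)

Section fubini.
Context {R : realType} {n : nat} (g : 'rV[R]_n.+1 -> R) (b : R).
Hypotheses (cg : continuous g) (g0 : forall x, ~ cube b x -> g x = 0).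

Let integrable_cons :
  ((lebesgue_measure \x @lebesgue_measure_rV R n)%E).-integrable setT
    (fun tv => (g (cons_rV tv))%:E).
Proof.
have mg := continuous_measurable_rV cg.
apply/integrableP; split.
  apply/measurable_EFinP; apply: (measurableT_comp mg).
  exact: measurable_cons_rV.
have /integrableP[_] := integrable_cube cg g0.
apply: le_lt_trans; rewrite le_eqVlt; apply/orP; left; apply/eqP.
(* In dimension [n.+1] the Lebesgue measure is by definition this pushforward, so the change of
   measure is a conversion. *)
rewrite -[RHS]/(\int[pushforward (lebesgue_measure \x @lebesgue_measure_rV R n)
  (@cons_rV R n)]_x `|(g x)%:E|)%E ge0_integral_pushforward//.
- exact: measurable_cons_rV.
- by apply: measurableT_comp => //; exact/measurable_EFinP.
Qed.

Let integral_cons :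
  (\int[lebesgue_measure_rV]_x (g x)%:E =
   \int[lebesgue_measure \x @lebesgue_measure_rV R n]_tv (g (cons_rV tv))%:E)%E.
Proof.
rewrite -[LHS]/(\int[pushforward (lebesgue_measure \x @lebesgue_measure_rV R n)
  (@cons_rV R n)]_x (g x)%:E)%E integral_pushforward//.
- exact: measurable_cons_rV.
- by apply/measurable_EFinP; exact: continuous_measurable_rV.
Qed.

Lemma integral_rV_cons1 : (\int[lebesgue_measure_rV]_x (g x)%:E =
  \int[lebesgue_measure]_t \int[lebesgue_measure_rV]_v (g (cons_rV (t, v)))%:E)%E.
Proof. by rewrite integral_cons// -(integral12_prod_meas1 integrable_cons). Qed.

Lemma integral_rV_cons2 : (\int[lebesgue_measure_rV]_x (g x)%:E =
  \int[lebesgue_measure_rV]_v \int[lebesgue_measure]_t (g (cons_rV (t, v)))%:E)%E.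
Proof. by rewrite integral_cons// -(integral21_prod_meas1 integrable_cons). Qed.

End fubini.

Lemma integral_derive_eq0 (R : realType) (psi g : R -> R) (b : R) :
  continuous g -> (forall x, is_derive x (1 : R) psi (g x)) ->
  (forall x, x \notin `[- b, b] -> psi x = 0) ->
  (forall x, x \notin `[- b, b] -> g x = 0) ->
  (\int[lebesgue_measure]_x (g x)%:E = 0)%E.
Proof.
(* As [c > |b|], [psi] vanishes at both endpoints of [[- c, c]], whatever the sign of [b]. *)
move=> cg dpsi psi0 g0; pose c : R := `|b| + 1.
have c0 : 0 < c by rewrite ltr_pwDr.
have bc : b < c by rewrite ltr_pwDr// ler_norm.
have cpsi : continuous psi.
  by move=> x; apply/differentiable_continuous/derivable1_diffP; exact: ex_derive.
transitivity (\int[lebesgue_measure]_(x in `[(- c)%R, c]) (g x)%:E)%E.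
  rewrite [RHS]integral_mkcond; apply: eq_integral => x _.
  rewrite patchE; case: ifPn => //; rewrite mem_setE => xc; rewrite g0//.
  by apply: contra xc; rewrite !in_itv/=; lra.
rewrite (@continuous_FTC2 _ g psi).
- by rewrite !psi0 ?subee//; rewrite in_itv/=; lra.
- by lra.
- exact: continuous_subspaceT.
- split; first by move=> x _; exact: ex_derive.
    exact/cvg_at_right_filter/cpsi.
  exact/cvg_at_left_filter/cpsi.
- by move=> x _; rewrite derive1E; exact: derive_val.
Qed.

(** Induction on the dimension. If [i] is the first axis, the inner integral runs along it and
    vanishes by the fundamental theorem of calculus; otherwise the first coordinate is frozen and
    the induction hypothesis applies to the slice. *)
Lemma integral_partial_eq0 (R : realType) n (i : 'I_n) (psi g : 'rV[R]_n -> R)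
    (b : R) : continuous g -> (forall x, is_derive x (delta_mx 0 i) psi (g x)) ->
  (forall x, ~ cube b x -> psi x = 0) -> (forall x, ~ cube b x -> g x = 0) ->
  (\int[lebesgue_measure_rV]_x (g x)%:E = 0)%E.
Proof.
elim: n => [|n IHn] in i psi g *; first by case: i.
move=> cg dpsi psi0 g0; case: (unliftP ord0 i) => [j ij|i0].
  rewrite (integral_rV_cons1 cg g0) integral0_eq// => t _.
  apply: (IHn j (fun v => psi (cons_rV (t, v)))).
  - by move=> v; apply: continuous_comp; [exact: cons_rV_continuous|exact: cg].
  - move=> v; have := dpsi (cons_rV (t, v)); rewrite ij => -[dp <-].
    split; last first.
      by rewrite /derive; under eq_fun do rewrite /= cons_rV_lift.
    move: dp; rewrite /derivable.
    by under [in X in _ -> X]eq_fun do rewrite /= cons_rV_lift.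
  - by move=> v bv; apply: psi0 => /cube_cons[].
  - by move=> v bv; apply: g0 => /cube_cons[].
rewrite (integral_rV_cons2 cg g0) integral0_eq// => v _.
apply: (@integral_derive_eq0 _ (fun t => psi (cons_rV (t, v))) _ b).
- by move=> t; apply: continuous_comp; [exact: cons_rV_continuous1|exact: cg].
- move=> t; have := dpsi (cons_rV (t, v)); rewrite i0 => -[dp <-].
  have E h : cons_rV (h *: 1 + t, v) = h *: delta_mx 0 ord0 + cons_rV (t, v).
    by rewrite -cons_rV0 /GRing.scale/= mulr1.
  split; last first.
    by rewrite /derive; under eq_fun do rewrite /= E.
  by move: dp; rewrite /derivable; under [in X in _ -> X]eq_fun do rewrite /= E.
- by move=> t /negP tb; apply: psi0 => /cube_cons[].
- by move=> t /negP tb; apply: g0 => /cube_cons[].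
Qed.

(** * Test functions and integration by parts against them *)

Section test_functions.
Context {R : realType} {n : nat}.
Implicit Types phi h : 'rV[R]_n -> R.

Lemma test_function_continuous phi : test_function phi -> continuous phi.
Proof. by move=> [sphi _]; have [] := sphi [::]. Qed.

Lemma test_function_is_derive phi i x : test_function phi ->
  is_derive x (delta_mx 0 i) phi (partial i phi x).
Proof. by move=> [sphi _]; apply: derivableP; have [_] := sphi [::]; apply. Qed.

Lemma test_function_partial_continuous phi i : test_function phi ->
  continuous (partial i phi).
Proof. by move=> [sphi _]; have [] := sphi [:: i]. Qed.

Lemma test_function_cube phi : test_function phi -> exists2 b,
  (forall x, ~ cube b x -> phi x = 0) &
  (forall x i, ~ cube b x -> partial i phi x = 0).
Proof.
move=> [_ cphi]; have [b supp_b] := compact_sub_cube cphi.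
have phi0 x : ~ closure [set x | phi x != 0] x -> phi x = 0.
  by move=> Kx; apply/eqP/negPn/negP => phix; apply: Kx; exact: subset_closure.
exists b => [x bx|x i bx]; first by apply: phi0 => /supp_b.
have -> : partial i phi x = 'D_(delta_mx 0 i) (cst (0 : R)) x; last first.
  exact: derive_cst.
(* The complement of the closed support is open, so [phi] agrees with the zero function near [x]. *)
apply: near_eq_derive; near=> y; rewrite phi0//.
near: y; apply: open_nbhs_nbhs; split; last by move/supp_b.
exact/closed_openC/closed_closure.
Unshelve. all: by end_near. Qed.

Lemma integrable_mul_test h phi : continuous h -> test_function phi ->
  lebesgue_measure_rV.-integrable setT (fun x => (h x * phi x)%:E).
Proof.
move=> ch tphi; have [b phi0 _] := test_function_cube tphi.
apply: (@integrable_cube _ _ (h \* phi) b) => [x|x bx].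
  by apply: continuousM; [exact: ch|exact: test_function_continuous].
by rewrite /= phi0// mulr0.
Qed.

Lemma integrable_mul_partial h phi i : continuous h -> test_function phi ->
  lebesgue_measure_rV.-integrable setT (fun x => (h x * partial i phi x)%:E).
Proof.
move=> ch tphi; have [b _ phi0] := test_function_cube tphi.
apply: (@integrable_cube _ _ (h \* partial i phi) b) => [x|x bx].
  by apply: continuousM; [exact: ch|exact: test_function_partial_continuous].
by rewrite /= phi0// mulr0.
Qed.

(** The partial derivative of the compactly supported product [h * phi] has integral zero. *)
Lemma integral_rV_by_parts i h dh phi : continuous h -> continuous dh ->
  (forall x, is_derive x (delta_mx 0 i) h (dh x)) -> test_function phi ->
  (\int[lebesgue_measure_rV]_x (h x * partial i phi x)%:E =
   - \int[lebesgue_measure_rV]_x (dh x * phi x)%:E)%E.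
Proof.
move=> ch cdh hdh tphi; have [b phi0 dphi0] := test_function_cube tphi.
have ih := integrable_mul_partial i ch tphi.
have idh := integrable_mul_test cdh tphi.
have cphi := test_function_continuous tphi.
have cdphi := @test_function_partial_continuous phi i tphi.
have : (\int[lebesgue_measure_rV]_x (h x * partial i phi x + dh x * phi x)%:E = 0)%E.
  apply: (@integral_partial_eq0 _ _ i (h * phi) _ b).
  - have : continuous (h \* partial i phi \+ dh \* phi).
      by move=> x; apply: continuousD; apply: continuousM;
        [exact: ch|exact: cdphi|exact: cdh|exact: cphi].
    exact.
  - move=> x; have := is_deriveM (hdh x) (test_function_is_derive i x tphi).
    suff -> : h x * partial i phi x + dh x * phi x =
      h x *: partial i phi x + phi x *: dh x by [].
    by rewrite /GRing.scale/= (mulrC (phi x)).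
  - by move=> x bx; rewrite -[LHS]/(h x * phi x) phi0// mulr0.
  - by move=> x bx; rewrite phi0// dphi0// !mulr0 addr0.
under eq_integral do rewrite EFinD.
rewrite integralD//=.
(* Both integrals are finite, so the equation can be solved in [R]. *)
rewrite -(fineK (integrable_fin_num _ ih))// -(fineK (integrable_fin_num _ idh))//.
by move=> /eqP; rewrite -EFinD eqe addr_eq0 => /eqP ->; rewrite EFinN.
Qed.

End test_functions.

(** * One-dimensional calculus *)

Lemma is_derive1_continuous (R : realType) (f : R -> R) (x d : R) :
  is_derive x (1 : R) f d -> {for x, continuous f}.
Proof.
by move=> df; apply/differentiable_continuous/derivable1_diffP; exact: ex_derive.
Qed.

Lemma is_derive_nincr (R : realType) (F d : R -> R) (a x y : R) :
  (forall z : R, a <= z -> is_derive z (1 : R) F (d z)) ->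
  (forall z : R, a <= z -> d z <= 0) -> a <= x -> x <= y -> F y <= F x.
Proof.
move=> dF d0; apply: (@ler0_derive1_nincry _ F a) => [z|z|].
- by rewrite in_itv/= andbT => /ltW/dF dz; exact: ex_derive.
- rewrite in_itv/= andbT => /ltW za; rewrite derive1E.
  by have dz := dF z za; rewrite derive_val; exact: d0.
- apply: derivable_within_continuous => z; rewrite in_itv/= andbT => /dF dz.
  exact: ex_derive.
Qed.

Lemma is_derive_MVT (R : realType) (F k : R -> R) (a b : R) : a < b ->
  (forall x, a <= x <= b -> is_derive x (1 : R) F (k x)) ->
  exists2 c, a < c < b & F b - F a = k c * (b - a).
Proof.
move=> ab dF.
have [y| |c] := @MVT _ F k _ _ ab.
- by rewrite in_itv/= => /andP[ay yb]; apply: dF; rewrite !ltW.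
- apply: derivable_within_continuous => z; rewrite in_itv/= => /dF dz.
  exact: ex_derive.
- by rewrite in_itv/= => c_ab ->; exists c.
Qed.

Lemma antiderivative (R : realType) (k : R -> R) (a : R) :
  (forall x, a <= x -> {for x, continuous k}) ->
  exists F : R -> R, forall x, a < x -> is_derive x (1 : R) F (k x).
Proof.
move=> ck; exists (fun x => (\int[lebesgue_measure]_(t in `[a, x]) k t)%R) => x ax.
have ik : lebesgue_measure.-integrable `[a, x + 1] (EFin \o k).
  apply: continuous_compact_integrable; first exact: segment_compact.
  apply: continuous_in_subspaceT => z; rewrite inE/= in_itv/= => /andP[az _].
  exact: ck.
have xx1 : x < x + 1 by lra.
have [dF F'] := continuous_FTC1_closed xx1 ik ax (ck x (ltW ax)).
by apply: DeriveDef; [exact: dF|rewrite -derive1E].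
Qed.

(** With [I] a primitive of [k], [w = sup I - I] is the integral of [k] from [r] to infinity. Since
    [I + Y] is non-increasing and [Y] is non-negative, [I] stays below [I r + Y r], which gives
    [w <= Y]; the supremum is approached, so [w] has infimum zero. *)
Lemma antiderivative_decay (R : realType) (k y Y : R -> R) :
  continuous k -> (forall r : R, 0 <= r -> 0 <= k r) ->
  (forall r : R, 0 < r -> 0 < k r) ->
  (forall r : R, 0 <= r -> k r <= y r) ->
  (forall r : R, 0 <= r -> is_derive r (1 : R) Y (- y r)) ->
  (forall r : R, 0 <= r -> 0 <= Y r) ->
  exists w : R -> R, [/\ forall r : R, 0 <= r -> is_derive r (1 : R) w (- k r),
    forall r, 0 <= r -> 0 < w r <= Y r &
    forall e : R, 0 < e -> exists2 r : R, 0 <= r & w r < e].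
Proof.
move=> ck k0 k_gt0 ky dY Y0.
(* The base point [- 1] makes the derivative at [0] two-sided. *)
have [I dI] := @antiderivative _ k (- 1) (fun x _ => ck x).
have dI0 (r : R) : 0 <= r -> is_derive r (1 : R) I (k r) by move=> r0; apply: dI; lra.
have I_ndecr r r' : 0 <= r -> r <= r' -> I r <= I r'.
  move=> r0 rr'; rewrite -lerN2.
  apply: (@is_derive_nincr _ (- I) (- k) 0) => // z z0.
    by apply: is_deriveN; exact: dI0.
  by rewrite oppr_le0; exact: k0.
have I_le r r' : 0 <= r -> r <= r' -> I r' + Y r' <= I r + Y r.
  apply: (@is_derive_nincr _ (I + Y) (fun z => k z - y z) 0) => z z0.
    by apply: is_deriveD; [exact: dI0|exact: dY].
  by rewrite subr_le0; exact: ky.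
have I_bound r r' : 0 <= r -> 0 <= r' -> I r' <= I r + Y r.
  move=> r0 r'0; have [rr'|/ltW r'r] := leP r r'.
    by rewrite (le_trans _ (I_le _ _ r0 rr'))// lerDl; exact: Y0.
  by rewrite (le_trans (I_ndecr _ _ r'0 r'r))// lerDl Y0.
pose S := I @` [set r | 0 <= r].
have supS : has_sup S.
  split; first by exists (I 0); exists 0 => /=.
  by exists (I 0 + Y 0) => _ [r r0 <-]; exact: I_bound.
exists (fun r => sup S - I r); split.
- move=> r r0; rewrite -[- k r]add0r; apply: is_deriveB; exact: dI0.
- move=> r r0; apply/andP; split; last first.
    rewrite lerBlDl; apply: ge_sup; first by case: supS.
    by move=> _ [r' r'0 <-]; exact: I_bound.
  (* Positivity is strict because [I] still grows between [r] and [r + 1]. *)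
  have r1 : r < r + 1 by lra.
  have [c c_r Ic] := is_derive_MVT r1 (fun z zr => dI0 z (le_trans r0 (andP zr).1)).
  rewrite subr_gt0 (@lt_le_trans _ _ (I (r + 1)))//.
    rewrite -subr_gt0 Ic mulr_gt0 ?subr_gt0//; apply: k_gt0.
    by move: c_r => /andP[rc _]; exact: le_lt_trans rc.
  apply: ub_le_sup; first by case: supS.
  by exists (r + 1) => //=; lra.
- move=> e e0; have [_ [r r0 <-] Ir] := sup_adherent e0 supS.
  by exists r => //; lra.
Unshelve. all: by end_near. Qed.

(* Since [th ^ (- a / 2) = 2], rescaling [s] by [th] doubles [C s ^ (- a / 2)]:
   if [P' s = Phi (C s ^ (- a / 2)) / s], then [D s = P s - P (th s)] has the
   increment of [Phi] as its derivative, yet it stays bounded because it is an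
   integral of [P'] over one dyadic interval. *)
Lemma dyadic_average (R : realType) (Phi : R -> R) (A a C s0 : R) :
  0 < a -> 0 < C -> 0 < s0 ->
  (forall z : R, 0 < z -> {for z, continuous Phi}) ->
  (forall z : R, 0 < z -> 0 <= Phi z <= A) ->
  let th := 2 `^ (- (2 / a)) in
  exists D : R -> R, forall s : R, s0 < s ->
    is_derive s (1 : R) D
      ((Phi (C * s `^ (- (a / 2))) - Phi (2 * (C * s `^ (- (a / 2))))) / s) /\
    0 <= D s <= A * (1 - th) / th.
Proof.
move=> a0 C0 s00 cPhi PhiA th.
have th0 : 0 < th by exact: powR_gt0.
have th1 : th < 1.
  have powR1e : 1 `^ (2 / a) = 1 :> R by rewrite powR1.
  by rewrite /th powRN invf_lt1 ?powR_gt0// -[ltLHS]powR1e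
    gt0_ltr_powR ?nnegrE ?divr_gt0 ?ltr1n.
have thE : th `^ (- (a / 2)) = 2.
  rewrite /th -powRrM (_ : _ * _ = 1) ?powRr1//; field.
  by rewrite gt_eqF.
pose psi t := Phi (C * t `^ (- (a / 2))) / t.
have cpsi t : 0 < t -> {for t, continuous psi}.
  move=> t0; rewrite /psi; apply: continuousM.
    apply: continuous_comp.
      apply: continuousM; first exact: cvg_cst.
      exact/is_derive1_continuous/is_derive1_powR.
    by apply: cPhi; rewrite mulr_gt0// powR_gt0.
  by apply: continuousV; [rewrite gt_eqF|exact: cvg_id].
(* [P] has to be differentiable at [th * s] as well as at [s]. *)
pose b := th * s0.
have b0 : 0 < b by rewrite mulr_gt0.
have [P dP] := @antiderivative _ psi b (fun x bx => cpsi x (lt_le_trans b0 bx)).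
exists (fun s => P s - P (th * s)) => s s0s.
have s_gt0 : 0 < s by exact: lt_trans s0s.
have bths : b < th * s by rewrite ltr_pM2l.
have thss : th * s < s by rewrite gtr_pMl.
split.
  have dths : is_derive s (1 : R) ( *%R th) th.
    rewrite -[X in is_derive _ _ _ X]mulr1; exact: is_deriveZ.
  have d1 : is_derive s (1 : R) (P \o *%R th) (psi (th * s) * th).
    by apply: is_derive1_comp; exact: dP.
  have d2 := dP s (lt_trans bths thss).
  have := is_deriveB d2 d1.
  suff -> : psi s - psi (th * s) * th =
    (Phi (C * s `^ (- (a / 2))) - Phi (2 * (C * s `^ (- (a / 2))))) / s by [].
  rewrite /psi powRM ?(ltW th0) ?(ltW s_gt0)// thE mulrCA; field.
  by rewrite !gt_eqF.
(* By the mean value theorem [D s = psi c * (s - th * s)] with [th * s < c], and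
   [psi c <= A / c < A / (th * s)] if [A > 0]; the factor [s] cancels. *)
have [c /andP[thsc cs] ->] :=
  is_derive_MVT thss (fun z zr => dP z (lt_le_trans bths (andP zr).1)).
have c0 : 0 < c by apply: lt_trans thsc; rewrite mulr_gt0.
have /andP[Phi0 Phi1] : 0 <= Phi (C * c `^ (- (a / 2))) <= A.
  by apply: PhiA; rewrite mulr_gt0// powR_gt0.
rewrite /psi; apply/andP; split.
  by rewrite mulr_ge0 ?subr_ge0 ?(ltW thss)// divr_ge0// ltW.
rewrite -mulrA -[leRHS]mulrA ler_pM//.
  by rewrite mulr_ge0 ?invr_ge0 ?(ltW c0)// subr_ge0 ltW.
rewrite mulrC ler_pdivrMr// mulrAC ler_pdivlMr//.
have -> : (s - th * s) * th = (1 - th) * (th * s) by ring.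
by rewrite ler_wpM2l ?subr_ge0 1?ltW.
Qed.

(** * The integral condition expressed by a bounded primitive *)

Section primitive.
Context {R : realType} (f : R -> R) (eps : R).
Hypothesis eps_gt0 : 0 < eps.
Hypothesis f_ge0 : forall z : R, 0 <= z -> 0 <= f z.
Hypothesis f_ndecr : {in `[0, eps] &, {homo f : x y / x <= y}}.

(** Monotone on the whole line, hence Borel measurable, whereas [f] is monotone on [[0, eps]]
    only. *)
Definition clamp (z : R) := f (Num.min (Num.max z 0) eps).

Lemma clampE z : 0 <= z <= eps -> clamp z = f z.
Proof. by move=> /andP[z0 zeps]; rewrite /clamp max_l// min_l. Qed.

Lemma clamp_ndecr : {homo clamp : x y / x <= y}.
Proof.
move=> x y xy; apply: f_ndecr.
- by rewrite in_itv/= le_min (ltW eps_gt0) ge_min le_max !lexx !orbT.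
- by rewrite in_itv/= le_min (ltW eps_gt0) ge_min le_max !lexx !orbT.
- by apply: le_min2; rewrite ?lexx//; apply: le_max2.
Qed.

Lemma measurable_clamp : measurable_fun setT clamp.
Proof. by apply: nondecreasing_measurable => //; exact: clamp_ndecr. Qed.

(** [Phi z] is the integral of [f t / t ^ (1 + N)] over []0, z]], and the increment over []z, 2 z]]
    is at least the length [z] times a lower bound of the integrand. *)
Lemma dyadic_primitive (N : R) : 0 < N ->
  (\int[lebesgue_measure]_(z in `]0%R, eps[) (f z / z `^ (1 + N))%:E < +oo)%E ->
  exists (Phi : R -> R) (A : R),
    [/\ forall z : R, 0 < z -> {for z, continuous Phi},
        forall z : R, 0 < z -> 0 <= Phi z <= A &
        forall z : R, 0 < z -> 2 * z < eps ->
          2 `^ (- (1 + N)) * (f z * z `^ (- N)) <= Phi (2 * z) - Phi z].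
Proof.
move=> N0 f_int; pose g z := f z / z `^ (1 + N).
have mg : measurable_fun `]0, eps[ g.
  apply: (eq_measurable_fun (fun z => clamp z * z `^ (- (1 + N)))).
    move=> z; rewrite inE/= in_itv/= => /andP[z0 ze].
    by rewrite clampE ?powRN// !ltW.
  apply: measurable_funM.
    exact: measurable_funTS measurable_clamp.
  exact: measurable_funTS (measurable_powR _).
have g0 z : z \in `]0, eps[ -> 0 <= g z.
  by rewrite in_itv/= => /andP[z0 _]; rewrite divr_ge0 ?powR_ge0 ?f_ge0 ?ltW.
have ig : lebesgue_measure.-integrable `]0, eps[ (EFin \o g).
  apply/integrableP; split; first exact/measurable_EFinP.
  under eq_integral => z zI.
    rewrite /= ger0_norm; last by apply: g0; rewrite inE in zI.
    over.
  exact: f_int.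
(* Extension by zero defines [Phi] beyond [eps] and bounds it by the total integral. *)
pose h := g \_ `]0, eps[.
have h0 z : 0 <= h z.
  by rewrite /h patchE; case: ifPn => // /[!inE]/= zI; exact: g0.
have ih : lebesgue_measure.-integrable setT (EFin \o h).
  rewrite /h -restrict_EFin; apply/integrable_restrict => //.
  by rewrite setTI.
have ihD D : measurable D -> lebesgue_measure.-integrable D (EFin \o h).
  by move=> mD; apply: integrableS ih.
exists (fun z => (\int[lebesgue_measure]_(t in `[0, z]) h t)%R).
exists (\int[lebesgue_measure]_t h t)%R; split.
- move=> z z0.
  apply: (@within_continuous_continuous _ _ _ 0 (z + 1)); last first.
  + by rewrite in_itv/= z0/= ltrDl.
  + apply: parameterized_integral_continuous; first by lra.
    exact: ihD.
  + by lra.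
- move=> z z0; rewrite Rintegral_ge0//= [leLHS]Rintegral_mkcond.
  apply: le_Rintegral => //.
    rewrite -restrict_EFin; apply/integrable_restrict => //.
    by rewrite setTI; exact: ihD.
  by move=> t _; rewrite patchE; case: ifP.
- move=> z z0 zeps.
  rewrite (@Rintegral_itvB _ h (BLeft 0) (BRight (2 * z)) z); last 3 first.
  + exact: ihD.
  + by rewrite bnd_simp ltW.
  + by rewrite bnd_simp; lra.
  have zz : z <= 2 * z by lra.
  (* On []z, 2 z]] the numerator is at least [f z] and the denominator at most its value at
     [2 * z]. *)
  pose m := f z * (2 * z) `^ (- (1 + N)).
  have -> : 2 `^ (- (1 + N)) * (f z * z `^ (- N)) =
      (\int[lebesgue_measure]_(t in `]z, (2 * z)]) m)%R.
    rewrite Rintegral_cst//= lebesgue_measure_itv/= lte_fin ifT; last by lra.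
    rewrite /= /m powRM ?(ltW z0)// (_ : 2 * z - z = z); last by ring.
    rewrite opprD [z `^ (- 1 + - N)]powRD; last by rewrite (gt_eqF z0) implybT.
    rewrite powR_inv1 ?(ltW z0)//; field.
    by rewrite gt_eqF.
  apply: le_Rintegral => //; last 2 first.
  + exact: ihD.
  + move=> t /=; rewrite in_itv/= => /andP[zt tz].
    have tI : t \in `]0, eps[ by rewrite in_itv/=; lra.
    rewrite /h patchE mem_set//= /g /m -powRN ler_pM ?powR_ge0 ?f_ge0 ?(ltW z0)//.
      by apply: f_ndecr; rewrite ?in_itv/=; lra.
    rewrite !powRN lef_pV2 ?posrE ?powR_gt0//; try lra.
    apply: ge0_ler_powR; rewrite ?nnegrE//; lra.
  apply: measurable_bounded_integrable => //.
    have : (@lebesgue_measure R `]z, (2 * z)%R] < +oo)%E.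
      by rewrite lebesgue_measure_itv/=; case: ifP; rewrite ?ltry.
    exact.
  exists `|m|; split => // M mM t _ /=; exact: ltW.
Qed.

End primitive.

(** * The radial profile *)

Lemma powR_sqr (R : realType) (x e : R) : 0 <= x -> (x ^+ 2) `^ (e / 2) = x `^ e.
Proof.
by move=> x0; rewrite -powR_mulrn// -powRrM mulrC divfK// pnatr_eq0.
Qed.

Lemma ler_powRN (R : realType) (x y e : R) : 0 <= e -> 0 < x -> x <= y ->
  y `^ (- e) <= x `^ (- e).
Proof.
move=> e0 x0 xy; have y0 := lt_le_trans x0 xy.
rewrite !powRN lef_pV2 ?posrE ?powR_gt0//.
by apply: ge0_ler_powR; rewrite ?nnegrE ?(ltW x0) ?(ltW y0).
Qed.

Lemma powR_norm_continuous (R : realType) (q : R) : 0 < q ->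
  continuous (fun x : R => `|x| `^ q).
Proof.
move=> q0 x; have [->|x0] := eqVneq x 0; last first.
  apply: (@continuous_comp _ _ _ (fun x : R => `|x|) (fun y => y `^ q)).
    exact: norm_continuous.
  by apply: is_derive1_continuous (is_derive1_powR _ _); rewrite normr_gt0.
apply/cvgrPdist_lt => e e0; apply/nbhs_ballP; exists (e `^ q^-1) => /=.
  exact: powR_gt0.
move=> y; rewrite /ball/= sub0r normrN => ye.
rewrite normr0 powR0 ?gt_eqF// sub0r normrN ger0_norm ?powR_ge0//.
have -> : e = (e `^ q^-1) `^ q by rewrite -powRrM mulVf ?gt_eqF// powRr1// ltW.
by apply: gt0_ltr_powR => //; rewrite ?nnegrE ?powR_ge0.
Qed.

(** The square and the absolute value give continuity on the whole line, although [Q] is controlled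
    on [[0, +oo[] only. *)
Lemma powR_radial_continuous (R : realType) (q : R) (Q : R -> R) : 0 < q ->
  (forall rho : R, 0 <= rho -> {for rho, continuous Q}) ->
  continuous (fun r : R => `|r * Q (r ^+ 2)| `^ q).
Proof.
move=> q0 cQ r.
apply: (@continuous_comp _ _ _ (fun r : R => r * Q (r ^+ 2))
  (fun x : R => `|x| `^ q)); last exact: powR_norm_continuous.
apply: continuousM; first exact: cvg_id.
apply: (@continuous_comp _ _ _ (fun r : R => r ^+ 2) Q).
  exact: exprn_continuous.
by apply: cQ; exact: sqr_ge0.
Qed.

Lemma is_derive_shift (R : realType) (g : R -> R) (l x d : R) :
  is_derive (x + l) (1 : R) g d -> is_derive x (1 : R) (fun y => g (y + l)) d.
Proof.
move=> dg; rewrite -[d]mulr1.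
apply: (@is_derive1_comp _ g (fun y : R => y + l)).
rewrite -[X in is_derive _ _ _ X]addr0.
exact: (@is_deriveD _ _ _ id (cst l)).
Qed.

(** The left-hand side is a constant times [M ^ (q * N)], a power larger than one. *)
Lemma small_mass (R : realType) (X K q N : R) : 0 <= X -> 0 < K -> 0 <= q ->
  1 < q * N -> exists2 M, 0 < M & X * (K * M `^ q) `^ N <= M.
Proof.
move=> X0 K0 q0 qN; pose X' := X * K `^ N.
have X'0 : 0 <= X' by rewrite mulr_ge0 ?powR_ge0.
have X'1 : 0 < X' + 1 by rewrite ltr_wpDl.
(* This choice makes [M ^ (q * N - 1)] equal to [1 / (X' + 1)]; adding [1] covers [X' = 0]. *)
pose M := (X' + 1) `^ (- (q * N - 1)^-1).
have M0 : 0 < M by exact: powR_gt0.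
exists M => //.
rewrite powRM ?powR_ge0 ?(ltW K0)// mulrA -/X' -powRrM.
rewrite -(mulr_powRB1 (ltW M0)); last lra.
rewrite {2}/M -powRrM mulNr mulVf; last by rewrite gt_eqF// subr_gt0.
rewrite powR_inv1 ?(ltW X'1)// mulrCA ger_pMr// ler_pdivrMr// mul1r; lra.
Qed.

Section profile.
Context {R : realType} (nu p eps A : R) (f Phi : R -> R).
Hypotheses (nu_ge1 : 1 <= nu) (p_gt1 : 1 < p) (p_lt_nu : p < nu).
Hypothesis eps_gt0 : 0 < eps.
Hypothesis f_ge0 : forall z : R, 0 <= z -> 0 <= f z.
Hypothesis f_ndecr : {in `[0, eps] &, {homo f : x y / x <= y}}.

(** [nu] is the dimension as a real number. The power [r ^ (- a)] is p-harmonic away from the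
    origin, [N = nu / a], and the power [q] turns the flux into the slope. *)
Let a := (nu - p) / (p - 1).
Let N := nu * (p - 1) / (nu - p).
Let q := (p - 1)^-1.

Hypothesis Phi_cont : forall z : R, 0 < z -> {for z, continuous Phi}.
Hypothesis Phi_bound : forall z : R, 0 < z -> 0 <= Phi z <= A.
Let c := 2 `^ (- (1 + N)) : R.
Hypothesis Phi_incr : forall z : R, 0 < z -> 2 * z < eps ->
  c * (f z * z `^ (- N)) <= Phi (2 * z) - Phi z.

Let p1 : 0 < p - 1. Proof. by rewrite subr_gt0. Qed.
Let nup : 0 < nu - p. Proof. by rewrite subr_gt0. Qed.
Let a0 : 0 < a. Proof. exact: divr_gt0. Qed.
Let nu0 : 0 < nu. Proof. exact: lt_le_trans nu_ge1. Qed.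
Let N0 : 0 < N. Proof. by rewrite divr_gt0// mulr_gt0. Qed.
Let q0 : 0 < q. Proof. by rewrite invr_gt0. Qed.
Let c0 : 0 < c. Proof. exact: powR_gt0. Qed.
Let aN : a * N = nu.
Proof. by rewrite /a /N; field; rewrite !gt_eqF. Qed.
Let aq : a + 1 = (nu - 1) * q.
Proof. by rewrite /a /q; field; rewrite gt_eqF. Qed.
Let qN : 1 < q * N.
Proof.
have -> : q * N = nu / (nu - p) by rewrite /q /N; field; rewrite !gt_eqF.
by rewrite ltr_pdivlMr// mul1r ltrBlDr ltrDl (lt_trans ltr01).
Qed.

Let th := 2 `^ (- (2 / a)) : R.
Let B := A * (1 - th) / th.
(** The factor that makes [y] dominate the slope [k] in [k_le]. *)
Let K := 2 `^ ((a + 1) / 2) / a.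
(** For [Z s <= delta] the point [2 * Z s] is still below [eps], as [Phi_incr] requires. *)
Let delta := eps / 4.
(** One summand for each smallness condition: the first keeps [mu] above [M / 2], the second makes
    the source near the origin exceed [f eps]. *)
Let X := 2 * B / c + 4 * 2 `^ (nu / 2) * delta `^ (- N) * f eps.

Let K0 : 0 < K. Proof. by rewrite divr_gt0// powR_gt0. Qed.
Let delta0 : 0 < delta. Proof. by rewrite divr_gt0. Qed.
Let f_eps0 : 0 <= f eps. Proof. exact/f_ge0/ltW. Qed.

(* [M] bounds the total mass of the source.  A profile of mass [M] lies below
   [Z (r^2 + lam)], where [Z] is a multiple of the fundamental solution
   [r ^ (- a)] and [lam] is such that [Z lam = delta]; as [q * N > 1],
   hypothesis [XM] holds once [M] is small. *)
Section mass.
Variables (M : R) (D : R -> R).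
Hypothesis M0 : 0 < M.
Let C := K * M `^ q.
Let l := (C / delta) `^ a^-1.
Let lam := l ^+ 2.
Hypothesis XM : X * C `^ N <= M.
Let Z s := C * s `^ (- (a / 2)).
Hypothesis D_derive : forall s : R, lam / 2 < s ->
  is_derive s (1 : R) D ((Phi (Z s) - Phi (2 * Z s)) / s).
Hypothesis D_bound : forall s : R, lam / 2 < s -> 0 <= D s <= B.

Let C0 : 0 < C. Proof. by rewrite mulr_gt0// powR_gt0. Qed.
Let l0 : 0 < l. Proof. by rewrite powR_gt0// divr_gt0. Qed.
Let lam0 : 0 < lam. Proof. exact: exprn_gt0. Qed.
Let lam_half s : lam <= s -> lam / 2 < s.
Proof. by move: lam0; lra. Qed.
Let B0 : 0 <= B.
Proof. by have /andP[] := D_bound (lam_half (lexx _)); exact: le_trans. Qed.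
Let CN0 : 0 < C `^ N. Proof. exact: powR_gt0. Qed.
(** Normalized so that [kap * c * Z s ^ (- N) = s ^ (nu / 2)], which cancels the prefactor of the
    divergence. *)
Let kap := C `^ N / c.
Let kap0 : 0 < kap. Proof. exact: divr_gt0. Qed.
Let mu s := M - kap * D s.
Let dmu s := kap * ((Phi (2 * Z s) - Phi (Z s)) / s).

(** The first summand of [X] in [XM] yields [2 * kap * B <= M]. *)
Let mu_bound s : lam <= s -> M / 2 <= mu s <= M.
Proof.
move=> /lam_half/D_bound/andP[D0 DB].
suff : kap * D s <= M / 2 by have := mulr_ge0 (ltW kap0) D0; rewrite /mu; lra.
have : kap * D s <= kap * B by rewrite ler_wpM2l// ltW.
have : 2 * B / c * C `^ N <= M.
  apply: le_trans XM; rewrite ler_wpM2r ?(ltW CN0)// lerDl.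
  by rewrite !mulr_ge0 ?powR_ge0.
have -> : 2 * B / c * C `^ N = 2 * (kap * B) by rewrite /kap; ring.
lra.
Qed.

Let Z_lam : Z lam = delta.
Proof.
rewrite /Z /lam -mulNr powR_sqr ?(ltW l0)// /l -powRrM.
rewrite mulrN mulVf ?gt_eqF// powR_inv1 ?divr_ge0 ?ltW//.
by field; rewrite !gt_eqF.
Qed.

Let Z_gt0 s : 0 < s -> 0 < Z s.
Proof. by move=> s0; rewrite mulr_gt0// powR_gt0. Qed.

Let Z_le s : lam <= s -> Z s <= delta.
Proof.
move=> ls; rewrite -Z_lam; apply: ler_wpM2l; first exact: ltW.
by rewrite ler_powRN// divr_ge0// ltW.
Qed.

(** The variable is [rho = |x|^2] rather than [|x|], so that the field [Q(|x|^2) x] is C^1 at the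
    origin too. *)
Let Q (rho : R) := (rho + lam) `^ (- (nu / 2)) * mu (rho + lam).
Let dQ (rho : R) :=
  - (nu / 2) * (rho + lam) `^ (- (nu / 2) - 1) * mu (rho + lam) +
  (rho + lam) `^ (- (nu / 2)) * dmu (rho + lam).

Let Q_gt0 rho : 0 <= rho -> 0 < Q rho.
Proof.
move=> rho0; have ls : lam <= rho + lam by rewrite lerDr.
have /andP[mu1 _] := mu_bound ls.
rewrite mulr_gt0//; first by rewrite powR_gt0// (lt_le_trans lam0).
by rewrite (lt_le_trans _ mu1)// divr_gt0.
Qed.

Let mu_derive s : lam <= s -> is_derive s (1 : R) mu (dmu s).
Proof.
move=> ls; have dD := D_derive (lam_half ls).
have : is_derive s (1 : R) (cst M - kap *: D)
  (0 - kap *: ((Phi (Z s) - Phi (2 * Z s)) / s)).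
  exact: is_deriveB.
suff -> : dmu s = 0 - kap *: ((Phi (Z s) - Phi (2 * Z s)) / s) by [].
by rewrite /dmu /GRing.scale/=; ring.
Qed.

Let Q_derive (rho : R) : 0 <= rho -> is_derive rho (1 : R) Q (dQ rho).
Proof.
move=> rho0; have ls : lam <= rho + lam by rewrite lerDr.
have s0 : 0 < rho + lam by rewrite (lt_le_trans lam0).
have d1 := is_derive_shift (mu_derive ls).
have d2 := is_derive_shift (is_derive1_powR (- (nu / 2)) s0).
have := is_deriveM d2 d1.
suff -> : dQ rho = (rho + lam) `^ (- (nu / 2)) *: dmu (rho + lam) +
  mu (rho + lam) *: (- (nu / 2) * (rho + lam) `^ (- (nu / 2) - 1)) by [].
by rewrite /dQ /GRing.scale/=; ring.
Qed.

Let powR_cont (e s : R) : 0 < s -> {for s, continuous (fun x : R => x `^ e)}.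
Proof. by move=> s0; apply: is_derive1_continuous; exact: is_derive1_powR. Qed.

Let dmu_cont s : lam <= s -> {for s, continuous dmu}.
Proof.
move=> ls; have s0 : 0 < s by exact: lt_le_trans lam0 ls.
have Zc : {for s, continuous Z}.
  by apply: continuousM; [exact: cvg_cst|exact: powR_cont].
apply: continuousM; first exact: cvg_cst.
apply: continuousM.
  apply: continuousB.
    apply: (@continuous_comp _ _ _ (fun s => 2 * Z s) Phi).
      by apply: continuousM => //; exact: cvg_cst.
    by apply: Phi_cont; rewrite mulr_gt0// Z_gt0.
  by apply: (@continuous_comp _ _ _ Z Phi) => //; apply: Phi_cont; exact: Z_gt0.
by apply: continuousV; [rewrite gt_eqF|exact: cvg_id].
Qed.

Let dQ_cont rho : 0 <= rho -> {for rho, continuous dQ}.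
Proof.
move=> rho0; have ls : lam <= rho + lam by rewrite lerDr.
have s0 : 0 < rho + lam by rewrite (lt_le_trans lam0).
pose g s := - (nu / 2) * s `^ (- (nu / 2) - 1) * mu s + s `^ (- (nu / 2)) * dmu s.
apply: (@continuous_comp _ _ _ (fun rho => rho + lam) g).
  by apply: continuousD; [exact: cvg_id|exact: cvg_cst].
apply: continuousD; apply: continuousM.
- by apply: continuousM; [exact: cvg_cst|exact: powR_cont].
- exact: is_derive1_continuous (mu_derive ls).
- exact: powR_cont.
- exact: dmu_cont.
Qed.

(* With [Q = s ^ (- nu / 2) * mu], the field [Q (|x|^2) x] would be
   divergence free for [lam = 0] and [mu] constant. *)
Let divergence rho (s := rho + lam) : 0 <= rho ->
  nu * Q rho + 2 * rho * dQ rho =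
  s `^ (- (nu / 2)) * (nu * lam / s * mu s + 2 * rho * dmu s).
Proof.
move=> rho0; have s0 : 0 < s by rewrite ltr_wpDl.
rewrite /Q /dQ -/s [s `^ (_ - 1)]powRD; last by rewrite (gt_eqF s0) implybT.
rewrite powR_inv1 ?(ltW s0)//.
have -> : rho = s - lam by rewrite /s addrK.
by field; rewrite gt_eqF.
Qed.

Let source rho : 0 <= rho ->
  f (Z (rho + lam)) <= nu * Q rho + 2 * rho * dQ rho.
Proof.
move=> rho0; rewrite divergence//; set s := rho + lam.
have ls : lam <= s by rewrite lerDr.
have s0 : 0 < s by rewrite (lt_le_trans lam0).
have Zs0 := Z_gt0 s0; have Zsd := Z_le ls.
have /andP[muM _] := mu_bound ls.
have incr : c * (f (Z s) * Z s `^ (- N)) <= Phi (2 * Z s) - Phi (Z s).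
  by apply: Phi_incr => //; move: Zsd delta0; rewrite /delta; lra.
have fZ0 : 0 <= f (Z s) by apply: f_ge0; exact: ltW.
have dPhi0 : 0 <= Phi (2 * Z s) - Phi (Z s).
  by apply: le_trans incr; rewrite !mulr_ge0 ?powR_ge0// ltW.
have dmu0 : 0 <= dmu s by rewrite mulr_ge0 ?(ltW kap0)// divr_ge0// ltW.
have mu0 : 0 <= mu s by apply: le_trans muM; rewrite divr_ge0// ltW.
(* For [rho >= lam] the term [dmu], built from the increment of [Phi], suffices;
   for [rho <= lam] the first term exceeds the constant [f eps]. *)
have [lrho|/ltW rhol] := leP lam rho.
  apply: (@le_trans _ _ (s `^ (- (nu / 2)) * (s * dmu s))).
    have -> : s * dmu s = kap * (Phi (2 * Z s) - Phi (Z s)).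
      by rewrite /dmu; field; rewrite gt_eqF.
    apply: (@le_trans _ _
      (s `^ (- (nu / 2)) * (kap * (c * (f (Z s) * Z s `^ (- N)))))); last first.
      by rewrite ler_wpM2l ?powR_ge0// ler_wpM2l// ltW.
    have -> : Z s `^ (- N) = C `^ (- N) * s `^ (nu / 2).
      rewrite /Z powRM ?(ltW C0) ?powR_ge0// -powRrM; congr (_ * _ `^ _).
      by rewrite mulrNN -mulrAC aN.
    rewrite /kap !powRN le_eqVlt; apply/orP; left; apply/eqP.
    by field; rewrite !gt_eqF ?powR_gt0.
  rewrite ler_wpM2l ?powR_ge0//.
  (* Here [lam <= rho] gives [s <= 2 * rho]. *)
  apply: (@le_trans _ _ (2 * rho * dmu s)).
    by rewrite ler_wpM2r// /s; lra.
  rewrite lerDr mulr_ge0// mulr_ge0 ?invr_ge0 ?(ltW s0)//.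
  by rewrite mulr_ge0 ?(ltW nu0) ?(ltW lam0).
apply: (@le_trans _ _ (f eps)).
  by apply: f_ndecr; rewrite ?in_itv/=; move: Zsd delta0; rewrite /delta; lra.
(* Here [s <= 2 * lam], so [nu * lam / s >= 1 / 2], and [mu s >= M / 2]; hence the constant
   [M / 4]. *)
apply: (@le_trans _ _ ((2 * lam) `^ (- (nu / 2)) * (M / 4))); last first.
  rewrite ler_pM ?powR_ge0//.
  - by rewrite divr_ge0// ltW.
  - by rewrite ler_powRN ?divr_ge0 ?(ltW nu0)// /s; lra.
  - apply: (@le_trans _ _ (nu * lam / s * mu s)); last first.
      by rewrite lerDl (mulr_ge0 (mulr_ge0 (ler0n _ 2) rho0) dmu0).
    have -> : M / 4 = 2^-1 * (M / 2) by field.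
    rewrite ler_pM// ?divr_ge0 ?(ltW M0)//.
    rewrite ler_pdivlMr//.
    have : lam <= nu * lam by rewrite ler_peMl// ltW.
    by rewrite /s; lra.
(* The definition of [l] is solved for [lam], using [a * N = nu]. *)
have lamN : lam `^ (- (nu / 2)) = delta `^ N * C `^ (- N).
  rewrite /lam -mulNr powR_sqr ?(ltW l0)// /l -powRrM -aN mulrN mulrA.
  rewrite mulVf ?gt_eqF// mul1r.
  rewrite powRM ?invr_ge0 ?(ltW C0) ?(ltW delta0)// mulrC; congr (_ * _).
  by rewrite -powR_inv1 ?(ltW delta0)// -powRrM mulN1r opprK.
rewrite powRM ?(ltW lam0)// lamN.
(* The second summand of [X] in [XM]. *)
have : 4 * 2 `^ (nu / 2) * delta `^ (- N) * f eps * C `^ N <= M.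
  apply: le_trans XM; rewrite ler_wpM2r ?(ltW CN0)// lerDr.
  exact: divr_ge0 (mulr_ge0 (ler0n _ 2) B0) (ltW c0).
rewrite !powRN.
have t0 : 0 < 2 `^ (nu / 2) :> R by exact: powR_gt0.
have d0 : 0 < delta `^ N by exact: powR_gt0.
move=> H.
have -> : (2 `^ (nu / 2))^-1 * (delta `^ N / C `^ N) * (M / 4) =
  M / (4 * 2 `^ (nu / 2) * (delta `^ N)^-1 * C `^ N).
  by field; rewrite !gt_eqF.
rewrite ler_pdivlMr ?mulr_gt0 ?invr_gt0//.
by apply: le_trans H; rewrite le_eqVlt; apply/orP; left; apply/eqP; ring.
Qed.

Let k r := `|r * Q (r ^+ 2)| `^ q.
(** A shifted fundamental solution. Near the origin [k] is of order [r ^ q], which for [q < 1] is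
    not dominated by the slope of [Z (r^2 + lam)], of order [r]; the slope [y] of the shifted
    function stays positive there. *)
Let Y r := C * (r + l) `^ (- a).
Let y r := C * (a * (r + l) `^ (- a - 1)).

Let k_cont : continuous k.
Proof.
apply: powR_radial_continuous => // rho rho0.
exact: is_derive1_continuous (Q_derive rho0).
Qed.

Let Y_derive (r : R) : 0 <= r -> is_derive r (1 : R) Y (- y r).
Proof.
move=> r0; have rl0 : 0 < r + l by rewrite ltr_wpDl.
have d1 := is_derive_shift (is_derive1_powR (- a) rl0).
have := @is_deriveZ _ _ _ _ C _ _ _ d1.
suff -> : - y r = C *: (- a * (r + l) `^ (- a - 1)) by [].
by rewrite /y /GRing.scale/=; ring.
Qed.

(** From [r <= s ^ (1 / 2)] and [mu s <= M] follows [k r <= s ^ (- (a + 1) / 2) * M ^ q], and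
    [(r + l)^2 <= 2 * s] because [lam = l^2]. *)
Let k_le (r : R) : 0 <= r -> k r <= y r.
Proof.
move=> r0; set s := r ^+ 2 + lam.
have ls : lam <= s by rewrite lerDr sqr_ge0.
have s0 : 0 < s by rewrite (lt_le_trans lam0).
have rl0 : 0 < r + l by rewrite ltr_wpDl.
have /andP[mu1 mu2] := mu_bound ls.
have mu0 : 0 <= mu s by rewrite (le_trans _ mu1)// divr_ge0// ltW.
have rs : r <= s `^ 2^-1.
  rewrite -[leLHS](powRr1 r0) -(powR_sqr 1 r0) div1r.
  by rewrite ge0_ler_powR ?nnegrE ?invr_ge0 ?sqr_ge0 ?(ltW s0)// lerDl ltW.
apply: (@le_trans _ _ ((s `^ 2^-1 * (s `^ (- (nu / 2)) * M)) `^ q)).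
  rewrite /k ger0_norm ?mulr_ge0 ?powR_ge0//.
  rewrite ge0_ler_powR ?nnegrE ?mulr_ge0 ?powR_ge0 ?(ltW q0) ?(ltW M0)//.
  by rewrite ler_pM ?mulr_ge0 ?powR_ge0// ler_wpM2l ?powR_ge0.
rewrite mulrA -powRD; last by rewrite (gt_eqF s0) implybT.
rewrite powRM ?powR_ge0 ?(ltW M0)// -powRrM.
have -> : (2^-1 + - (nu / 2)) * q = - ((a + 1) / 2) by rewrite aq; field.
have -> : y r = 2 `^ ((a + 1) / 2) * (r + l) `^ (- (a + 1)) * M `^ q.
  by rewrite /y /C /K opprD; field; rewrite gt_eqF.
rewrite ler_wpM2r ?powR_ge0//.
have -> : 2 `^ ((a + 1) / 2) * (r + l) `^ (- (a + 1)) =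
  ((r + l) ^+ 2 / 2) `^ (- ((a + 1) / 2)).
  rewrite powRM ?invr_ge0 ?sqr_ge0// -[in RHS]mulNr powR_sqr ?(ltW rl0)// mulrC.
  congr (_ * _); rewrite -powR_inv1// -powRrM; congr (_ `^ _); lra.
apply: ler_powRN; [by move: a0; lra|by rewrite divr_gt0// exprn_gt0|].
rewrite /s /lam -subr_ge0 (_ : _ - _ = (r - l) ^+ 2 / 2) ?divr_ge0 ?sqr_ge0//.
by field.
Qed.

Let Y_le (r : R) : 0 <= r -> Y r <= Z (r ^+ 2 + lam).
Proof.
move=> r0; have rl0 : 0 < r + l by rewrite ltr_wpDl.
rewrite ler_wpM2l ?(ltW C0)// -(@powR_sqr _ (r + l)) ?(ltW rl0)// mulNr.
apply: ler_powRN; first by rewrite divr_ge0// ltW.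
  by rewrite ltr_wpDl ?sqr_ge0.
rewrite -subr_ge0 (_ : _ - _ = 2 * (r * l)); last by rewrite /lam; ring.
by rewrite mulr_ge0// mulr_ge0// ltW.
Qed.

(** The chain [w r <= Y r <= Z (r^2 + lam) <= delta] stays inside [[0, eps]], so monotonicity of [f]
    transfers the bound [source] from [Z] to [w]. *)
Lemma profile_of_mass : exists Q dQ w : R -> R,
  [/\ forall rho : R, 0 <= rho ->
        [/\ is_derive rho (1 : R) Q (dQ rho), {for rho, continuous dQ} & 0 < Q rho],
      forall r : R, 0 <= r -> is_derive r (1 : R) w (- `|r * Q (r ^+ 2)| `^ q),
      forall r : R, 0 <= r -> [/\ 0 < w r, w r <= eps &
        f (w r) <= nu * Q (r ^+ 2) + 2 * r ^+ 2 * dQ (r ^+ 2)] &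
      forall e : R, 0 < e -> exists2 r : R, 0 <= r & w r < e].
Proof.
have [||||||w [dw wY w0]] := @antiderivative_decay _ k y Y.
- exact: k_cont.
- by move=> r _; exact: powR_ge0.
- move=> r r0; rewrite powR_gt0// normr_gt0 mulf_neq0 ?gt_eqF ?Q_gt0 ?sqr_ge0//.
- exact: k_le.
- exact: Y_derive.
- by move=> r r0; rewrite mulr_ge0 ?powR_ge0// ltW.
exists Q, dQ, w; split => //.
  by move=> rho rho0; split; [exact: Q_derive|exact: dQ_cont|exact: Q_gt0].
move=> r r0; have /andP[wr0 wrY] := wY r r0.
have ls : lam <= r ^+ 2 + lam by rewrite lerDr sqr_ge0.
have wZ := le_trans wrY (Y_le r0).
have Zd := Z_le ls.
have de : delta <= eps by move: eps_gt0; rewrite /delta; lra.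
split => //; first exact: le_trans (le_trans wZ Zd) de.
apply: le_trans (source (sqr_ge0 r)); apply: f_ndecr => //.
- by rewrite in_itv/= (ltW wr0) (le_trans wZ)// (le_trans Zd).
- by rewrite in_itv/= (le_trans (ltW wr0) wZ)/= (le_trans Zd).
Qed.

End mass.

Lemma profile : exists Q dQ w : R -> R,
  [/\ forall rho : R, 0 <= rho ->
        [/\ is_derive rho (1 : R) Q (dQ rho), {for rho, continuous dQ} & 0 < Q rho],
      forall r : R, 0 <= r -> is_derive r (1 : R) w (- `|r * Q (r ^+ 2)| `^ q),
      forall r : R, 0 <= r -> [/\ 0 < w r, w r <= eps &
        f (w r) <= nu * Q (r ^+ 2) + 2 * r ^+ 2 * dQ (r ^+ 2)] &
      forall e : R, 0 < e -> exists2 r : R, 0 <= r & w r < e].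
Proof.
(* [B] depends neither on [C] nor on [s0], so any instance of [dyadic_average] reveals its sign. *)
have B0 : 0 <= B.
  have [D /(_ 2 (ltr1n _ 2))[_ /andP[D0]]] :=
    dyadic_average a0 ltr01 ltr01 Phi_cont Phi_bound.
  exact: le_trans D0.
have X0 : 0 <= X.
  apply: addr_ge0; first exact: divr_ge0 (mulr_ge0 (ler0n _ 2) B0) (ltW c0).
  apply: mulr_ge0 f_eps0; apply: mulr_ge0 (powR_ge0 _ _).
  exact: mulr_ge0 (ler0n _ 4) (powR_ge0 _ _).
(* [X] and [K] do not involve [M], so [M] is chosen first and determines [C], [lam] and [D]. *)
have [M M0 XM] := small_mass X0 K0 (ltW q0) qN.
have C0 : 0 < K * M `^ q by rewrite mulr_gt0// powR_gt0.
(* Starting at [lam / 2] makes [D] differentiable on both sides of [s = lam], that is, of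
   [rho = 0]. *)
have lam0 : 0 < ((K * M `^ q / delta) `^ a^-1) ^+ 2 / 2.
  by rewrite divr_gt0// exprn_gt0// powR_gt0// divr_gt0.
have [D D_prop] := dyadic_average a0 C0 lam0 Phi_cont Phi_bound.
by apply: (@profile_of_mass M D) => // s /D_prop[].
Qed.

End profile.

(** * Radial functions on R^n *)

Section euclidean.
Context {R : realType} {n : nat}.
Implicit Types (x v : 'rV[R]_n) (i : 'I_n).

Lemma dotrv_ge0 x : 0 <= dotrv x x.
Proof. by apply: sumr_ge0 => i _; rewrite -expr2 sqr_ge0. Qed.

Lemma enorm_ge0 x : 0 <= enorm x.
Proof. exact: sqrtr_ge0. Qed.

Lemma sqr_enorm x : enorm x ^+ 2 = dotrv x x.
Proof. by rewrite sqr_sqrtr// dotrv_ge0. Qed.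

Lemma ler_coord_enorm x i : `|x 0 i| <= enorm x.
Proof.
rewrite -sqrtr_sqr ler_wsqrtr// /dotrv (bigD1 i)//= -expr2 lerDl.
by apply: sumr_ge0 => j _; rewrite -expr2 sqr_ge0.
Qed.

Lemma enorm_eq0 x : enorm x = 0 -> x = 0.
Proof.
move=> x0; apply/rowP => i; rewrite mxE; apply/eqP; rewrite -normr_le0 -x0.
exact: ler_coord_enorm.
Qed.

Lemma enormZ a x : enorm (a *: x) = `|a| * enorm x.
Proof.
rewrite /enorm /dotrv -sqrtr_sqr -sqrtrM ?sqr_ge0//; congr Num.sqrt.
by rewrite mulr_sumr; apply: eq_bigr => i _; rewrite !mxE; ring.
Qed.

Lemma continuous_rVM (f g : 'rV[R]_n -> R) : continuous f -> continuous g ->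
  continuous (fun x => f x * g x).
Proof. by move=> cf cg x; exact: (@continuousM _ _ f g x (cf x) (cg x)). Qed.

Lemma continuous_rVD (f g : 'rV[R]_n -> R) : continuous f -> continuous g ->
  continuous (fun x => f x + g x).
Proof. by move=> cf cg x; exact: (@continuousD _ _ _ f g x (cf x) (cg x)). Qed.

Lemma continuous_rVN (f : 'rV[R]_n -> R) : continuous f ->
  continuous (fun x => - f x).
Proof. by move=> cf x; exact: (@continuousN _ _ _ f x (cf x)). Qed.

Lemma dotrv_continuous : continuous (fun x => dotrv x x).
Proof.
apply: continuous_big => [|i _ x].
  exact: add_continuous.
by apply: continuousM; exact: coord_continuous.
Qed.

Lemma enorm_continuous : continuous (@enorm R n).
Proof.
move=> x; apply: (@continuous_comp _ _ _ (fun x => dotrv x x) Num.sqrt).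
  exact: dotrv_continuous.
exact: sqrt_continuous.
Qed.

Lemma dotrv_line x i t :
  dotrv (t *: delta_mx 0 i + x) (t *: delta_mx 0 i + x) =
  dotrv x x + 2 * x 0 i * t + t ^+ 2.
Proof.
rewrite /dotrv (bigD1 i)//= [in RHS](bigD1 i)//= !mxE !eqxx /=.
rewrite (eq_bigr (fun j => x 0 j * x 0 j)); last first.
  by move=> j /negPf ji; rewrite !mxE ji andbF mulr0 add0r.
ring.
Qed.

(** Reduces directional derivatives to calculus in one variable. *)
Lemma is_derive_line (h : 'rV[R]_n -> R) x v d :
  is_derive (0 : R) (1 : R) (fun t => h (t *: v + x)) d -> is_derive x v h d.
Proof.
have E : (fun t : R => t^-1 *: (((fun t => h (t *: v + x)) \o shift 0) (t *: 1)
      - h (0 *: v + x))) =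
    (fun t : R => t^-1 *: ((h \o shift x) (t *: v) - h x)).
  apply/funext => t /=; rewrite scale0r add0r addr0.
  by congr (_ *: (h (_ *: _ + _) - _)); exact: mulr1.
by move=> [+ <-]; rewrite /derivable /derive E.
Qed.

End euclidean.

Lemma is_derive_quadratic (R : realType) (c b : R) :
  is_derive (0 : R) (1 : R) (fun t => c + b * t + t ^+ 2) b.
Proof.
apply: is_derive_eq; rewrite /GRing.scale/=; ring.
Qed.

(** The difference quotient at [t] has the same absolute value as that of [w] at [|t|]. *)
Lemma is_derive_norm_0 (R : realType) (w : R -> R) :
  is_derive (0 : R) (1 : R) w 0 -> is_derive (0 : R) (1 : R) (fun t => w `|t|) 0.
Proof.
move=> [/cvg_ex[d wd] w0].
have d0 : d = 0.
  by rewrite -w0 /derive; apply/esym/cvg_lim.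
rewrite {}d0 {w0} in wd.
suff H : (fun h : R => h^-1 *:
    (((fun t : R => w `|t|) \o shift (0 : R)) (h *: (1 : R)) - w `|0 : R|))
    @ 0^' --> (0 : R).
  split; first by apply/cvg_ex; exists 0.
  exact: cvg_lim H.
apply/cvgrPdist_lt => e e0; move/cvgrPdist_lt : wd => /(_ e e0).
move=> wd.
have /nbhs_ballP[r /= r0 re] : nbhs (0 : R) (fun t : R => t != 0 ->
  `|0 - t^-1 *: ((w \o shift (0 : R)) (t *: (1 : R)) - w 0)| < e) by exact: wd.
suff : nbhs (0 : R) (fun t : R => t != 0 -> `|0 - t^-1 *:
  (((fun t : R => w `|t|) \o shift (0 : R)) (t *: (1 : R)) - w `|0 : R|)| < e) by [].
apply/nbhs_ballP; exists r => //= t rt t0.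
have := re `|t| _ _; rewrite /ball/= !sub0r !normrN normr_id normr_eq0.
move: rt; rewrite /ball/= sub0r normrN => rt /(_ rt t0).
rewrite /GRing.scale/= !mulr1 !addr0 normr0 !normrM !normfV normr_id.
exact.
Qed.

Section radial.
Context {R : realType} {n : nat}.
Variables (p : R) (Q dQ w : R -> R).
Hypothesis p_gt1 : 1 < p.
Let q := (p - 1)^-1.
Hypothesis Q_prop : forall rho : R, 0 <= rho ->
  [/\ is_derive rho (1 : R) Q (dQ rho), {for rho, continuous dQ} & 0 < Q rho].
Hypothesis w_derive : forall r : R, 0 <= r ->
  is_derive r (1 : R) w (- `|r * Q (r ^+ 2)| `^ q).

(* [u] is radial with slope [- k], so that [|G|^(p-2) G = V = - Q (|x|^2) x]. *)
Let k r := `|r * Q (r ^+ 2)| `^ q.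
Let u (x : 'rV[R]_n) := w (enorm x).
Let G (x : 'rV[R]_n) : 'rV[R]_n := (- k (enorm x) / enorm x) *: x.
Let V i (x : 'rV[R]_n) : R := - Q (dotrv x x) * x 0 i.
Let dV i (x : 'rV[R]_n) : R :=
  - (Q (dotrv x x) + 2 * x 0 i ^+ 2 * dQ (dotrv x x)).

Let q0 : 0 < q. Proof. by rewrite invr_gt0 subr_gt0. Qed.

Let k0 : k 0 = 0.
Proof. by rewrite /k mul0r normr0 powR0// gt_eqF. Qed.

Let k_cont : continuous k.
Proof.
apply: powR_radial_continuous => // rho /Q_prop[dq _ _].
exact: is_derive1_continuous dq.
Qed.

Lemma radial_continuous : continuous u.
Proof.
move=> x; apply: (@continuous_comp _ _ _ (@enorm R n) w).
  exact: enorm_continuous.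
exact: is_derive1_continuous (w_derive (enorm_ge0 x)).
Qed.

(** Away from the origin this is the chain rule; at the origin, where the Euclidean norm is not
    differentiable, the slope [k 0] vanishes. *)
Lemma radial_derive x i : is_derive x (delta_mx 0 i) u (G x 0 i).
Proof.
apply: is_derive_line; rewrite /u /enorm.
under eq_fun do rewrite dotrv_line.
have [x0|x0] := eqVneq (enorm x) 0.
  rewrite (enorm_eq0 x0) !mxE !mulr0.
  have -> : dotrv (0 : 'rV[R]_n) 0 = 0.
    by apply: big1 => j _; rewrite mxE mulr0.
  under eq_fun do rewrite mul0r !add0r sqrtr_sqr.
  apply: is_derive_norm_0.
  by have := w_derive (lexx 0); rewrite -/(k 0) k0 oppr0.
have x_gt0 : 0 < enorm x by rewrite lt_neqAle eq_sym x0 enorm_ge0.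
have rho0 : 0 < dotrv x x by rewrite -sqr_enorm exprn_gt0.
pose g (t : R) := dotrv x x + 2 * x 0 i * t + t ^+ 2.
have g0 : g 0 = dotrv x x by rewrite /g mulr0 expr0n/= !addr0.
have dg : is_derive (0 : R) (1 : R) g (2 * x 0 i) by exact: is_derive_quadratic.
have ds : is_derive (g 0) (1 : R) Num.sqrt (2 * Num.sqrt (g 0))^-1.
  by apply: is_derive1_sqrt; rewrite g0.
have dsg := is_derive1_comp ds dg.
have dw : is_derive ((Num.sqrt \o g) 0) (1 : R) w (- k ((Num.sqrt \o g) 0)).
  by apply: w_derive; exact: sqrtr_ge0.
have := is_derive1_comp dw dsg.
suff -> : G x 0 i =
    - k ((Num.sqrt \o g) 0) * ((2 * Num.sqrt (g 0))^-1 * (2 * x 0 i)) by [].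
rewrite /= g0 -/(enorm x) mxE; field.
by rewrite gt_eqF.
Qed.

(** At the origin continuity follows from [|G x 0 i| <= k (enorm x)]. *)
Lemma radial_gradient_continuous i : continuous (fun x => G x 0 i).
Proof.
move=> x; have [x0|x0] := eqVneq (enorm x) 0.
  have Gx : G x 0 i = 0 by rewrite (enorm_eq0 x0) !mxE mulr0.
  move=> S /nbhs_ballP[e /= e0 eS].
  have kx : {for x, continuous (k \o @enorm R n)}.
    by apply: continuous_comp; [exact: enorm_continuous|exact: k_cont].
  have nk := kx (ball (k (enorm x)) e) (nbhsx_ballx _ _ e0).
  apply: (@filterS _ (nbhs (x : 'rV[R]_n)) _ _ _ _ nk) => y /=.
  rewrite x0 k0 /ball/= sub0r normrN => ky.
  apply: eS; rewrite Gx /ball/= sub0r normrN; apply: le_lt_trans ky.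
  rewrite mxE normrM normrM normrN normfV (ger0_norm (enorm_ge0 y)) -mulrA.
  rewrite ler_piMr//.
  have [->|y0] := eqVneq (enorm y) 0; first by rewrite invr0 mul0r.
  by rewrite mulrC ler_pdivrMr ?mul1r ?ler_coord_enorm// lt_neqAle eq_sym y0 enorm_ge0.
have -> : (fun x => G x 0 i) = (fun x => - k (enorm x) / enorm x * x 0 i).
  by apply/funext => y; rewrite mxE.
have c1 : {for x, continuous (fun y : 'rV[R]_n => k (enorm y))}.
  apply: (@continuous_comp _ _ _ (@enorm R n) k).
    exact: enorm_continuous.
  exact: k_cont.
have c2 : {for x, continuous (fun y : 'rV[R]_n => (enorm y)^-1)}.
  by apply: continuousV => //; exact: enorm_continuous.
apply: (@continuousM _ _ (fun y : 'rV[R]_n => - k (enorm y) / enorm y)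
  (fun y : 'rV[R]_n => y 0 i)); last exact: coord_continuous.
by apply: continuousM => //; exact: continuousN.
Qed.

(** As [q * (p - 1) = 1], the power [k ^ (p - 1)] is [|x| Q(|x|^2)]; at the origin both [G] and [V]
    vanish, also for [p < 2]. *)
Lemma radial_flux x y :
  enorm (G x) `^ (p - 2) * dotrv (G x) y = \sum_(i < n) V i x * y 0 i.
Proof.
have [x0|x0] := eqVneq (enorm x) 0.
  rewrite (enorm_eq0 x0) /G scaler0 /dotrv !big1 ?mulr0// => i _.
    by rewrite /V mxE mulr0 mul0r.
  by rewrite mxE mul0r.
have x_gt0 : 0 < enorm x by rewrite lt_neqAle eq_sym x0 enorm_ge0.
have [_ _ Qx] := Q_prop (dotrv_ge0 x).
have rQ : 0 < enorm x * Q (dotrv x x) by rewrite mulr_gt0.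
have kE : k (enorm x) = (enorm x * Q (dotrv x x)) `^ q.
  by rewrite /k sqr_enorm gtr0_norm.
have k_gt0 : 0 < k (enorm x) by rewrite kE powR_gt0.
rewrite /G enormZ normrM normrN normfV (gtr0_norm k_gt0) (gtr0_norm x_gt0).
rewrite divfK// /dotrv mulr_sumr; apply: eq_bigr => i _; rewrite mxE /V.
suff kp : k (enorm x) `^ (p - 2) * k (enorm x) = enorm x * Q (dotrv x x).
  transitivity (- (k (enorm x) `^ (p - 2) * k (enorm x)) / enorm x * x 0 i * y 0 i).
    by ring.
  by rewrite kp; field.
rewrite -[X in _ * X](powRr1 (ltW k_gt0)) -powRD; last first.
  by rewrite (gt_eqF k_gt0) implybT.
rewrite kE -powRrM (_ : q * (p - 2 + 1) = 1) ?powRr1 ?(ltW rQ)//.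
by rewrite /q; field; rewrite gt_eqF// subr_gt0.
Qed.

Let Q_cont : continuous (fun x : 'rV[R]_n => Q (dotrv x x)).
Proof.
move=> x; apply: (@continuous_comp _ _ _ (fun x => dotrv x x) Q).
  exact: dotrv_continuous.
by have [dq _ _] := Q_prop (dotrv_ge0 x); exact: is_derive1_continuous dq.
Qed.

Let dQ_cont : continuous (fun x : 'rV[R]_n => dQ (dotrv x x)).
Proof.
move=> x; apply: (@continuous_comp _ _ _ (fun x => dotrv x x) dQ).
  exact: dotrv_continuous.
by have [] := Q_prop (dotrv_ge0 x).
Qed.

Lemma radial_flux_continuous i : continuous (V i).
Proof.
by apply: continuous_rVM; [exact: continuous_rVN|exact: coord_continuous].
Qed.

Lemma radial_flux_derive_continuous i : continuous (dV i).
Proof.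
apply: continuous_rVN; apply: continuous_rVD => //.
apply: continuous_rVM => //; apply: continuous_rVM.
  exact: (@cst_continuous _ _ (2 : R)).
by apply: continuous_rVM; exact: coord_continuous.
Qed.

Lemma radial_flux_derive x i : is_derive x (delta_mx 0 i) (V i) (dV i x).
Proof.
apply: is_derive_line; rewrite /V.
under eq_fun do rewrite dotrv_line.
have [dq _ _] := Q_prop (dotrv_ge0 x).
pose g (t : R) := dotrv x x + 2 * x 0 i * t + t ^+ 2.
have g0 : g 0 = dotrv x x by rewrite /g mulr0 expr0n/= !addr0.
have dg : is_derive (0 : R) (1 : R) g (2 * x 0 i) by exact: is_derive_quadratic.
rewrite -g0 in dq.
have dQg := is_deriveN (is_derive1_comp dq dg).
have dx : is_derive (0 : R) (1 : R) (fun t : R => t + x 0 i) 1.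
  rewrite -[X in is_derive _ _ _ X]addr0.
  exact: (@is_deriveD _ _ _ id (cst (x 0 i))).
have := is_deriveM dQg dx.
have -> : (- (Q \o g) * (fun t : R => t + x 0 i)) =
    (fun t => - Q (g t) * (t *: delta_mx 0 i + x) 0 i).
  by apply/funext => t; rewrite !mxE !eqxx mulr1.
suff -> : dV i x = (- (Q \o g)) 0 *: 1 + (0 + x 0 i) *: - (dQ (g 0) * (2 * x 0 i)) by [].
rewrite /dV -[(- (Q \o g)) 0]/(- Q (g 0)) g0 /GRing.scale/=; ring.
Qed.

Lemma radial_divergence x :
  \sum_(i < n) - dV i x = n%:R * Q (dotrv x x) + 2 * dotrv x x * dQ (dotrv x x).
Proof.
under eq_bigr do rewrite /dV opprK.
rewrite big_split/= sumr_const card_ord mulr_natl; congr (_ + _).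
by rewrite -mulr_suml -mulr_sumr.
Qed.

End radial.

(** * Solutions of the differential inequality *)

Section solution.
Context {R : realType} {n : nat}.
Implicit Types (u : 'rV[R]_n -> R).

(** Covers [f \o u], which need not be continuous. *)
Lemma Lploc_locally_bounded (p : R) u : 0 <= p -> measurable_fun setT u ->
  (forall K, compact K -> exists M : R, forall x, K x -> `|u x| <= M) -> Lploc p u.
Proof.
move=> p0 mu bu; split => // K cK.
have mK := compact_measurable_rV cK.
have [M uM] := bu K cK.
have muK : (lebesgue_measure_rV K < +oo)%E.
  have [b Kb] := compact_sub_cube cK.
  apply: le_lt_trans (lebesgue_measure_cube_fin n b).
  by apply: le_measure; rewrite ?inE//; exact: measurable_cube.
apply: (@le_lt_trans _ _ (\int[lebesgue_measure_rV]_(x in K) (cst (`|M| `^ p)%:E) x)%E).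
  apply: ge0_le_integral => //.
  - apply/measurable_EFinP; apply: (measurableT_comp (@measurable_powR R p)).
    by apply: measurableT_comp => //; exact: measurable_funTS.
  - move=> x Kx; rewrite lee_fin ge0_ler_powR ?nnegrE//.
    exact: le_trans (uM x Kx) (ler_norm M).
by rewrite integral_cst// lte_mul_pinfty// lee_fin powR_ge0.
Qed.

Lemma Lploc_continuous (p : R) u : 0 <= p -> continuous u -> Lploc p u.
Proof.
move=> p0 cu; apply: Lploc_locally_bounded => //.
  exact: continuous_measurable_rV.
move=> K cK; have : compact (u @` K).
  by apply: continuous_compact => //; exact: continuous_subspaceT.
move=> /compact_bounded[M [_ uM]]; exists (`|M| + 1) => x Kx.
by apply: (uM (`|M| + 1)); [rewrite ltr_pwDr// ler_norm|exists x].
Qed.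

Lemma open_not_negligible (U : set 'rV[R]_n) x : open U -> U x ->
  ~ lebesgue_measure_rV.-negligible U.
Proof.
move=> oU Ux [A [mA A0 UA]].
have /nbhs_ballP[e /= e0 eU] : nbhs x U by exact: open_nbhs_nbhs.
pose B : set 'rV[R]_n := [set v | forall i, v 0 i \in `]x 0 i - e, x 0 i + e[].
have BA : B `<=` A.
  move=> v Bv; apply/UA/eU/rV_ballE => // i.
  by have := Bv i; rewrite in_itv/= distrC ltr_distl.
have mB : measurable B.
  exact: (@measurable_rV_box _ _ (fun i => [set` `]x 0 i - e, x 0 i + e[])).
have : (lebesgue_measure_rV B <= 0)%E.
  by rewrite -A0; apply: le_measure; rewrite ?inE.
rewrite (@lebesgue_measure_rV_box _ _ (fun i => [set` `]x 0 i - e, x 0 i + e[]))//.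
rewrite leNgt => /negP; apply.
apply: (big_ind (fun y => 0 < y)%E) => //= [y z|i _]; first exact: mule_gt0.
rewrite lebesgue_measure_itv/= lte_fin ifT; last by lra.
by rewrite -EFinB lte_fin; lra.
Qed.

(** For each [e > 0] the set where [u < e] is open and non-empty, hence not negligible. *)
Lemma ess_inf_continuous_eq0 u : continuous u -> (forall x, 0 < u x) ->
  (forall e : R, 0 < e -> exists x, u x < e) ->
  ess_inf lebesgue_measure_rV (EFin \o u) = 0%E.
Proof.
move=> cu u0 uinf; apply/eqP; rewrite eq_le; apply/andP; split; last first.
  by apply/ess_infP; apply: nearW => x; rewrite lee_fin ltW.
apply: ge_ereal_sup => y [A [mA A0 yA]].
rewrite leNgt; apply/negP => y0.
have [e e0 ey] : exists2 e : R, 0 < e & (e%:E <= y)%E.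
  move: y y0 {yA} => [r r0|_|//]; last by exists 1; rewrite ?leey.
  by exists r.
have [x uxe] := uinf e e0.
have oU : open (u @^-1` [set r | r < e]).
  by apply: open_comp => [z _|]; [exact: cu|exact: open_lt].
apply: (open_not_negligible oU uxe); exists A; split => // z /= uze.
apply: yA => /=; apply/negP; rewrite -ltNge; apply: lt_le_trans ey.
by rewrite lte_fin.
Qed.

(** A pointwise inequality for the divergence of a C^1 flux [V] becomes the weak one after
    multiplication by [phi] and integration by parts in each coordinate. *)
Lemma plaplace_solution_divergence p (f : R -> R) u (G : 'rV[R]_n -> 'rV[R]_n)
    (V dV : 'I_n -> 'rV[R]_n -> R) : 0 <= p ->
  continuous u -> (forall i, continuous (fun x => G x 0 i)) ->
  (forall x i, is_derive x (delta_mx 0 i) u (G x 0 i)) ->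
  (forall i, continuous (V i)) -> (forall i, continuous (dV i)) ->
  (forall x i, is_derive x (delta_mx 0 i) (V i) (dV i x)) ->
  (forall x y, enorm (G x) `^ (p - 2) * dotrv (G x) y =
    \sum_(i < n) V i x * y 0 i) ->
  Lploc 1 (f \o u) -> (forall x, 0 <= f (u x)) ->
  (forall x, f (u x) <= \sum_(i < n) - dV i x) ->
  plaplace_solution p f u.
Proof.
move=> p0 cu cG uG cV cdV dVE GV Lf f0 fdV; exists G.
  split; [exact: Lploc_continuous|by move=> i; exact: Lploc_continuous|].
  move=> phi tphi i; apply: integral_rV_by_parts => // x; exact: uG.
split => // phi tphi phi0.
have cphi := test_function_continuous tphi.
have mfphi : measurable_fun setT (fun x => f (u x) * phi x).
  apply: measurable_funM; first by case: Lf.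
  exact: continuous_measurable_rV.
rewrite [leRHS](_ : _ = \int[lebesgue_measure_rV]_x
    (\sum_(i < n) (- dV i x * phi x))%:E)%E; last first.
  under eq_integral do rewrite GV -sumEFin.
  rewrite integral_sum//; last first.
    move=> i; under eq_fun do rewrite mxE.
    exact: integrable_mul_partial.
  under [RHS]eq_integral do rewrite -sumEFin.
  rewrite integral_sum//; last first.
    move=> i; apply: (@integrable_mul_test _ _ (fun x => - dV i x)) => //.
    exact: continuous_rVN.
  apply: eq_bigr => i _; under eq_integral do rewrite mxE.
  rewrite (@integral_rV_by_parts _ _ _ _ (dV i))//.
  under [RHS]eq_integral do rewrite mulNr EFinN.
  rewrite integralN//; apply: integrable_add_def => //.
  exact: integrable_mul_test.
apply: ge0_le_integral => //.
- by move=> x _; rewrite lee_fin mulr_ge0.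
- exact/measurable_EFinP.
- apply/measurable_EFinP; apply: measurable_sum => i.
  apply: measurable_funM; last exact: continuous_measurable_rV.
  by apply: continuous_measurable_rV; exact: continuous_rVN.
- by move=> x _; rewrite lee_fin -mulr_suml ler_wpM2r.
Qed.

End solution.

Theorem theorem2p2 (R : realType) (n : nat) (p eps : R) (f : R -> R)
  (n_ge2 : (2 <= n)%N) (p_gt1 : 1 < p) (p_lt_n : p < n%:R)
  (eps_gt0 : 0 < eps)
  (f_ge0 : forall z : R, 0 <= z -> 0 <= f z)
  (f_ndecr : {in `[0, eps] &, {homo f : x y / x <= y}})
  (f_int : (\int[lebesgue_measure]_(z in `]0%R, eps[)
     (f z / z `^ (1 + n%:R * (p - 1) / (n%:R - p)))%:E < +oo)%E) :
  exists u : 'rV[R]_n -> R,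
    [/\ forall x, 0 < u x,
        plaplace_solution p f u &
        ess_inf lebesgue_measure_rV (EFin \o u) = 0%E].
Proof.
have n_ge1 : 1 <= n%:R :> R by rewrite ler1n (leq_trans _ n_ge2).
have N0 : 0 < n%:R * (p - 1) / (n%:R - p).
  by rewrite divr_gt0 ?mulr_gt0 ?subr_gt0// (lt_le_trans ltr01).
have [Phi [A [cPhi PhiA dPhi]]] :=
  dyadic_primitive eps_gt0 f_ge0 f_ndecr N0 f_int.
have [Q [dQ [w [QE wE wf w0]]]] :=
  profile n_ge1 p_gt1 p_lt_n eps_gt0 f_ge0 f_ndecr cPhi PhiA dPhi.
pose u (x : 'rV[R]_n) := w (enorm x).
have u_bound x : [/\ 0 < u x, u x <= eps & 0 <= f (u x) <= f eps].
  have [u0 ueps _] := wf _ (enorm_ge0 x); split => //.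
  rewrite f_ge0 ?(ltW u0)//= f_ndecr ?in_itv/= ?(ltW u0) ?ueps//.
  by rewrite (ltW eps_gt0) lexx.
have cu : continuous u by exact: radial_continuous wE.
exists u; split; first by move=> x; have [] := u_bound x.
- have cG := radial_gradient_continuous p_gt1 QE.
  have uG := radial_derive p_gt1 wE.
  have cV := radial_flux_continuous QE.
  have cdV := radial_flux_derive_continuous QE.
  have VdV := radial_flux_derive QE.
  have GV := radial_flux p_gt1 QE.
  refine (plaplace_solution_divergence _ cu (cG _) (@uG _) (cV _) (cdV _)
    (@VdV _) (@GV _) _ _ _).
  + by apply: ltW; exact: lt_trans p_gt1.
  + apply: Lploc_locally_bounded; first exact: ler01.
      (* The values of [u] lie in []0, eps]], where [f] agrees with a measurable function. *)
      rewrite (_ : f \o u = clamp f eps \o u); last first.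
        apply/funext => x /=; have [u0 ueps _] := u_bound x.
        by rewrite clampE// (ltW u0).
      apply: measurableT_comp; first exact: measurable_clamp.
      exact: continuous_measurable_rV.
    move=> K _; exists (f eps) => x _ /=; have [_ _ /andP[f0 feps]] := u_bound x.
    by rewrite ger0_norm.
  + by move=> x; have [_ _ /andP[]] := u_bound x.
  + move=> x; rewrite radial_divergence -sqr_enorm.
    by have [] := wf _ (enorm_ge0 x).
- apply: ess_inf_continuous_eq0 => //.
    by move=> x; have [] := u_bound x.
  move=> e /w0[r r0 wr].
  (* A point at distance [r] from the origin, taken on a coordinate axis. *)
  pose i0 := Ordinal (leq_trans (isT : (0 < 2)%N) n_ge2).
  exists (r *: delta_mx 0 i0); rewrite /u enormZ ger0_norm//.
  have -> : enorm (delta_mx 0 i0 : 'rV[R]_n) = 1.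
    rewrite /enorm /dotrv (bigD1 i0)//= big1 ?mxE ?eqxx ?addr0 ?mulr1 ?sqrtr1//.
    by move=> j /negPf ji; rewrite mxE ji andbF mulr0.
  by rewrite mulr1.
Qed.
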